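(* Let $n\ge3$ and let $s$ be an integer with $s\ge\lceil n/2\rceil$. Then the $s$th topological complexity of $C\Omega_n$ is maximal, that is, $TC_s(C\Omega_n)=s(n-2)$.
   Context: $C\Omega_n$ is (a cubical structure on) the anchored configuration space of the circle with two anchored points: the subspace of $(S^1)^n$ consisting of all tuples $(p_1,\dots,p_n)$ with $S\subseteq\{p_1,\dots,p_n\}$, where $S\subset S^1$ is a fixed set of two points. Concretely, its cells are the tuples $(x_1,y_1,x_2,y_2,x_3,y_3,x_4,y_4)$ of pairwise disjoint sets with union $\{1,\dots,n\}$ and $x_3\ne\emptyset\neq x_4$, of dimension $\sum_i|y_i|$, describing $n$ labelled points on the cycle graph $C_4$ ($x_i$: points at vertex $i$; $y_i$: points in the open edge from vertex $i$ to vertex $i+1$, indices mod 4), with vertices 3 and 4 being the anchored points. For $s\ge2$ and a path-connected space $X$, $TC_s(X)$ is the (reduced) $s$th topological complexity: $TC_s(X)+1$ is the smallest number of open sets covering $X^s$ on each of which the map $e_s:PX\to X^s$, $e_s(\gamma)=\left(\gamma\left(\frac{0}{s-1}\right),\gamma\left(\frac{1}{s-1}\right),\dots,\gamma\left(\frac{s-1}{s-1}\right)\right)$, admits a continuous section, where $PX$ is the space of continuous paths $[0,1]\to X$. ''Maximal'' refers to the general upper bound $TC_s(X)\le s\dim X$ for a path-connected CW complex $X$, with $\dim C\Omega_n=n-2$. *)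

(* Defs.v *)
From HB Require Import structures.
From mathcomp Require Import all_boot all_order all_algebra.
From mathcomp Require Import all_classical all_reals all_analysis.
Import Order.TTheory GRing.Theory Num.Theory numFieldNormedType.Exports.

Set Implicit Arguments.
Unset Strict Implicit.
Unset Printing Implicit Defensive.

Local Open Scope classical_set_scope.
Local Open Scope ring_scope.

(* A set coerces to the subtype of its elements ([set_type]), which carries the
   topology induced from the ambient space. *)

Definition unit_interval (R : realType) : set R := `[0, 1].
Arguments unit_interval : clear implicits.

Definition circle (R : realType) : set (R * R)%type :=
  [set z | z.1 ^+ 2 + z.2 ^+ 2 = 1].
Arguments circle : clear implicits.

(* The tuples of [n] points of the circle are given the product topology. *)
Definition anchored_conf (R : realType) (n : nat) (S : set (circle R)) :
    set {ptws 'I_n -> circle R} :=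
  [set p | S `<=` range p].
Arguments anchored_conf R n S : clear implicits.

Section TopologicalComplexity.
Variables (R : realType) (s : nat) (X : topologicalType).

Definition path_space : set {compact-open, unit_interval R -> X} :=
  [set gamma | continuous (gamma : unit_interval R -> X)].

Lemma sample_time_subproof (k : 'I_s) :
  (k%:R / (s.-1)%:R : R) \in unit_interval R.
Proof.
have ks : (k <= s.-1)%N by case: s k => [[]//|m] k /=; rewrite -ltnS.
rewrite inE /unit_interval /= in_itv /= divr_ge0 //=.
have [->|s0] := posnP s.-1; first by rewrite invr0 mulr0 ler01.
by rewrite ler_pdivrMr ?ltr0n// mul1r ler_nat.
Qed.

Definition sample_time (k : 'I_s) : unit_interval R :=
  exist _ (k%:R / (s.-1)%:R) (sample_time_subproof k).

Definition path_eval (gamma : path_space) : {ptws 'I_s -> X} :=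
  fun k => \val gamma (sample_time k).

Definition has_local_section (U : set {ptws 'I_s -> X}) : Prop :=
  exists sigma : U -> path_space,
    continuous sigma /\ forall u : U, path_eval (sigma u) = \val u.

Definition motion_cover (N : nat) : Prop :=
  exists U : 'I_N -> set {ptws 'I_s -> X},
    [/\ forall i, open (U i), \bigcup_i U i = setT
      & forall i, has_local_section (U i)].

(* [TC_eq k] is "TC_s(X) = k" for the reduced invariant; it holds for no [k]
   when no finite cover exists. *)
Definition TC_eq (k : nat) : Prop :=
  motion_cover k.+1 /\ forall N, motion_cover N -> (k.+1 <= N)%N.

End TopologicalComplexity.

Arguments TC_eq R s X k : clear implicits.

(* Main.v *)
(* Upper bound.  For rho > 0 let U_rho be the set of tuples in X^s none of whose
   coordinates is at height exactly rho or -rho above the chord ab.  On U_rho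
   every coordinate can be slid along the circle to a locally constant target,
   a and b staying fixed; as X is path-connected (n >= 3) this gives a section
   of the evaluation map over U_rho.  A tuple has at most s (n - 2) coordinates
   off the chord, so among s (n - 2) + 1 values of rho one is avoided.

   Lower bound.  Since n <= 2 s, one can choose for each k < s two indices that
   are held at a and b in the k-th configuration, in such a way that every index
   is held in some configuration.  The remaining s (n - 2) coordinates run
   through a torus.  Over a set with a local section, the path of the i-th point
   joins a moving coordinate to a held one, so its winding number mod 2
   trivialises there the degree one class of that coordinate.  The product of
   these s (n - 2) classes is the fundamental class, so s (n - 2) such sets do
   not cover the torus.  This cup product is computed on a fine cubical grid. *)
Require Import Defs.
From mathcomp Require Import all_boot all_order all_algebra.
From mathcomp Require Import all_classical all_reals all_analysis.
From mathcomp Require Import lra ring zify.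

Import Order.TTheory GRing.Theory Num.Theory numFieldNormedType.Exports.

Set Implicit Arguments.
Unset Strict Implicit.
Unset Printing Implicit Defensive.

Local Open Scope ring_scope.

(** * Cup products of quasi-periodic functions on a cubical grid *)

Section CubicalCup.
Variable K : finType.
Implicit Types (v w : K -> nat) (f g : (K -> nat) -> 'F_2) (D : {set K}).

Definition shift (j : K) (x : nat) v : K -> nat := fun c => (v c + (c == j) * x)%N.

Definition diff (j : K) f : (K -> nat) -> 'F_2 := fun v => f (shift j 1 v) - f v.

Lemma shiftC i j x y v : shift i x (shift j y v) = shift j y (shift i x v).
Proof. by apply/funext => c; rewrite /shift addnAC. Qed.

Lemma shiftD j x y v : shift j x (shift j y v) = shift j (y + x) v.
Proof. by apply/funext => c; rewrite /shift -addnA mulnDr. Qed.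

Lemma shift0 j v : shift j 0 v = v.
Proof. by apply/funext => c; rewrite /shift muln0 addn0. Qed.

Lemma F2_addrr (x : 'F_2) : x + x = 0.
Proof. by rewrite -mulr2n; apply: mulrn_pchar; exact: pchar_Fp. Qed.

Lemma F2_oppr (x : 'F_2) : - x = x.
Proof. by apply/eqP; rewrite eq_sym -addr_eq0 F2_addrr. Qed.

(** The terms [(i, j)] and [(j, i)] cancel modulo 2. This is what makes the square of the coboundary
    vanish below. *)
Lemma sum_sym_offdiag D (h : K -> K -> 'F_2) :
  (forall i j, h i j = h j i) ->
  \sum_(j in D) \sum_(i in D :\ j) h i j = 0.
Proof.
move=> hC; rewrite pair_big_dep /=.
rewrite (bigID (fun p => (enum_rank p.1 < enum_rank p.2)%N)) /=.
rewrite [X in _ + X](reindex_inj (h := fun p => (p.2, p.1))) /=; last first.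
  by move=> [a b] [c d] /= [-> ->].
rewrite [X in X + _](_ : _ = \sum_(j | (j.2 \in D) && (j.1 \in D :\ j.2)
   && ~~ (enum_rank j.2 < enum_rank j.1)%N) h j.1 j.2) ?F2_addrr //; last first.
apply: eq_big => [[i j] /=|[i j] _ /=]; last exact: hC.
rewrite !inE -leqNgt; case: (eqVneq i j) => [->|ij]; first by rewrite ltnn !andbF.
rewrite [in RHS]leq_eqVlt.
have /negPf-> : (enum_rank i : nat) != enum_rank j.
  by apply: contra ij => /eqP/ord_inj/enum_rank_inj ->.
by case: (i \in D); case: (j \in D); rewrite //= ?eq_sym.
Qed.

Variable z : K -> (K -> nat) -> 'F_2.

(* The value at [v] of the cup product of the coboundaries of the [z d],
   [d \in ds], on the cube with corner [v] and edge directions [D]. *)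
Fixpoint cup (ds : seq K) D : (K -> nat) -> 'F_2 :=
  if ds is d :: ds' then
    fun v => \sum_(j in D) diff j (z d) v * cup ds' (D :\ j) (shift j 1 v)
  else fun=> 1.

(** Leibniz rule: [z d] is differenced at [v] while the other factor sits at the shifted corner, as
    in [cup]. *)
Lemma diff_cup_sum d ds D v :
  \sum_(j in D) diff j (fun w => z d w * cup ds (D :\ j) w) v =
  cup (d :: ds) D v + z d v * \sum_(j in D) diff j (cup ds (D :\ j)) v.
Proof.
rewrite /= mulr_sumr -big_split /=; apply: eq_bigr => j _.
by rewrite /diff mulrBl mulrBr addrA subrK.
Qed.

Lemma diff_sum (I : finType) (Q : pred I) j (F : I -> (K -> nat) -> 'F_2) v :
  diff j (fun w => \sum_(i | Q i) F i w) v = \sum_(i | Q i) diff j (F i) v.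
Proof. by rewrite /diff -sumrB. Qed.

(** A cup product of coboundaries is a cocycle: by induction it is the coboundary of [z d] times the
    shorter product, and second differences commute, so they cancel in pairs. *)
Lemma cup_closed ds D v : \sum_(j in D) diff j (cup ds (D :\ j)) v = 0.
Proof.
elim: ds D v => [|d ds IH] D v; first by rewrite big1 // => j _;
  rewrite /diff subrr.
have E D' : cup (d :: ds) D' =
    fun w => \sum_(i in D') diff i (fun w => z d w * cup ds (D' :\ i) w) w.
  by apply/funext => w; rewrite diff_cup_sum IH mulr0 addr0.
under eq_bigr => j _ do rewrite E diff_sum.
pose G A := fun w => z d w * cup ds A w.
apply: (@sum_sym_offdiag D (fun i j =>
  diff j (diff i (G (D :\ j :\ i))) v)) => i j.
rewrite !finset.setDDl finset.setUC /diff shiftC !opprB.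
by rewrite addrCA [RHS]addrC -!addrA; congr (_ + _); rewrite addrCA addrA.
Qed.

Lemma cup_exact d ds D v :
  cup (d :: ds) D v = \sum_(j in D) diff j (fun w => z d w * cup ds (D :\ j) w) v.
Proof. by rewrite diff_cup_sum cup_closed mulr0 addr0. Qed.

(** * Summation over boxes and quasi-periodic functions *)

Variable L : nat.

(** Evaluation of a cochain on a box of side [L]; for a periodic cochain, its value on the
    fundamental class of the torus spanned by [js]. *)
Fixpoint boxsum (js : seq K) f : (K -> nat) -> 'F_2 :=
  if js is j :: js' then fun v => \sum_(x < L) boxsum js' f (shift j x v) else f.

Lemma boxsum_ext js f g v : (forall w, f w = g w) -> boxsum js f v = boxsum js g v.
Proof. by move=> fg; congr boxsum; apply/funext. Qed.

Lemma boxsum_shift js f i x v :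
  boxsum js f (shift i x v) = boxsum js (fun w => f (shift i x w)) v.
Proof. by elim: js v => //= j js IH v; apply: eq_bigr => y _;
  rewrite shiftC IH. Qed.

Lemma boxsumB js f g v :
  boxsum js (fun w => f w - g w) v = boxsum js f v - boxsum js g v.
Proof.
by elim: js v => //= j js IH v; rewrite -sumrB; apply: eq_bigr => y _; rewrite IH.
Qed.

Lemma boxsum_sum js (I : finType) (Q : pred I) (F : I -> (K -> nat) -> 'F_2) v :
  boxsum js (fun w => \sum_(i | Q i) F i w) v = \sum_(i | Q i) boxsum js (F i) v.
Proof.
elim: js v => //= j js IH v; rewrite exchange_big /=.
by apply: eq_bigr => x _; rewrite IH.
Qed.

Lemma boxsum0 js f v : (forall w, f w = 0) -> boxsum js f v = 0.
Proof. by move=> f0; elim: js v => //= j js IH v; rewrite big1. Qed.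

Lemma boxsum_diff_head j js f v :
  boxsum (j :: js) (diff j f) v = boxsum js (fun w => f (shift j L w) - f w) v.
Proof.
rewrite /= boxsumB -boxsum_shift.
under eq_bigr => x _ do rewrite boxsumB -boxsum_shift shiftD addn1.
rewrite -(big_mkord xpredT (fun x => boxsum js f (shift j x.+1 v) - boxsum js f
  (shift j x v))).
by rewrite telescope_sumr // shift0.
Qed.

(** The sum along [j] telescopes, and the two opposite faces of the box carry the same values. *)
Lemma boxsum_diff_periodic j js f v : j \in js ->
  (forall w, f (shift j L w) = f w) -> boxsum js (diff j f) v = 0.
Proof.
move=> + fP; elim: js v => // i js IH v; rewrite inE => /predU1P[<-|jjs].
  by rewrite boxsum_diff_head boxsum0 // => w; rewrite fP subrr.
by rewrite /= big1 // => x _; rewrite IH.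
Qed.

Arguments boxsum : simpl never.

(** [z d] stands for a multivalued function on the torus with monodromy 1 around direction [d] only.
    Its coboundary is periodic and represents the [d]-th degree one class. *)
Hypothesis z_quasi_periodic :
  forall d j v, z d (shift j L v) = z d v + (d == j)%:R.

Lemma cup_periodic ds D j v : cup ds D (shift j L v) = cup ds D v.
Proof.
elim: ds D v => //= d ds IH D v; apply: eq_bigr => i _.
by rewrite /diff shiftC IH !z_quasi_periodic opprD addrACA subrr addr0.
Qed.

(** By [cup_exact] the sum reduces to boundary terms. Only direction [d] contributes, with the jump
    1 of [z d] times the shorter product, whose sum is 1 by induction. *)
Lemma boxsum_cup ds v : uniq ds -> boxsum ds (cup ds [set x in ds]) v = 1.
Proof.
elim: ds v => // d ds IH v /= /andP[dds uds].
rewrite -[LHS]/(boxsum (d :: ds) (cup (d :: ds) [set x in d :: ds]) v).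
rewrite (boxsum_ext _ _ (cup_exact _ _ _)) boxsum_sum.
have sD : [set x in d :: ds] :\ d = [set x in ds].
  apply/finset.setP => x; rewrite !inE; case: eqVneq => [->|//].
  by rewrite (negPf dds).
have dD : d \in [set x in d :: ds] by rewrite inE mem_head.
rewrite (bigD1 d dD) /= [X in _ + X]big1 ?addr0; last first.
  move=> j /andP[]; rewrite -[_ j]/(j \in [set x in d :: ds]) finset.in_set =>
    jds jd.
  apply: boxsum_diff_periodic => // w.
  by rewrite cup_periodic z_quasi_periodic eq_sym (negPf jd) addr0.
rewrite sD boxsum_diff_head (@boxsum_ext _ _ (cup ds [set x in ds])) ?IH // => w.
by rewrite cup_periodic z_quasi_periodic eqxx mulrDl mul1r addrC addKr.
Qed.

Definition in_cube D v w := forall c, (v c <= w c <= v c + (c \in D))%N.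

(** A nonzero term of the expanded product is a monotone edge path in the cube along which each
    [z d] in turn changes its value. *)
Lemma cup_neq0 ds D v : cup ds D v != 0 ->
  forall d, d \in ds -> exists w w',
    [/\ in_cube D v w, in_cube D v w' & z d w != z d w'].
Proof.
elim: ds D v => // d ds IH D v /= s0 d'.
have [j jD] : exists2 j, j \in D & diff j (z d) v * cup ds (D :\ j)
  (shift j 1 v) != 0.
  by apply/exists_inP; apply: contraR s0 => /exists_inPn s0;
    rewrite big1 // => j /s0/negPn/eqP.
rewrite mulf_eq0 negb_or => /andP[dz cz].
have cj c : (c == j) -> c \in D by move/eqP->.
rewrite inE => /predU1P[->|d'ds].
  exists (shift j 1 v), v; split; last by rewrite -subr_eq0.
    by move=> c; rewrite /shift muln1 leq_addr leq_add2l /=;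
      case: (c =P j) => // ->; rewrite jD.
  by move=> c; rewrite leqnn leq_addr.
have [w [w' [vw vw' zw]]] := IH _ _ cz _ d'ds.
have sub x : in_cube (D :\ j) (shift j 1 v) x -> in_cube D v x.
  move=> vx c; have := vx c; rewrite /shift muln1 !inE.
  case: eqVneq => [->|_] /=; rewrite ?jD ?addn0 ?addn1; last by [].
  by move=> /andP[/ltnW -> ->].
by exists w, w'; split => //; exact: sub.
Qed.

(** Otherwise all values of the cup product would vanish, against [boxsum_cup]. The lower bound
    contradicts this lemma with a [z] for which some [z d] does not vary on the cube. *)
Lemma quasi_periodic_cube (ds : seq K) : uniq ds ->
  exists v, forall d, d \in ds -> exists w w',
    [/\ in_cube [set: K] v w, in_cube [set: K] v w' & z d w != z d w'].
Proof.
move=> uds; have [v cv] : exists v, cup ds [set x in ds] v != 0.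
  apply: contrapT => /forallNP c0; have := boxsum_cup (fun=> 0%N) uds.
  rewrite boxsum0 => [/eqP|w]; first by rewrite eq_sym oner_eq0.
  by apply/eqP/negPn/negP; exact: c0.
exists v => d /(cup_neq0 cv)[w [w' [vw vw' zw]]].
have sub x : in_cube [set x in ds] v x -> in_cube [set: K] v x.
  move=> vx c; have /andP[-> /leq_trans] := vx c; apply.
  by rewrite leq_add2l finset.in_setT; case: (_ \in _).
by exists w, w'; split => //; exact: sub.
Qed.

End CubicalCup.

Local Open Scope classical_set_scope.

(** * Local sections and joint continuity *)

Lemma ptws_cvgP (I : Type) (X : topologicalType) (F : set_system {ptws I -> X})
    (f : {ptws I -> X}) : Filter F ->
  F --> f <-> forall i, (fun g : {ptws I -> X} => g i) @ F --> f i.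
Proof.
move=> FF; rewrite cvg_sup; split=> H i.
  apply: cvg_trans (@initial_continuous _ _ (fun g : I -> X => g i) f).
  exact: (cvg_app _ (H i)).
move=> A [B /= [[C oC <-] Cf] BA]; apply: filterS BA _.
by apply: (H i); exact: open_nbhs_nbhs.
Qed.

Lemma ptws_continuousP (I : Type) (X Z : topologicalType)
  (f : Z -> {ptws I -> X}) z :
  {for z, continuous f} <-> forall i, {for z, continuous (fun y => f y i)}.
Proof. exact: ptws_cvgP. Qed.

Lemma ptws_eval_continuous (I : Type) (X : topologicalType) (i : I) :
  continuous (fun g : {ptws I -> X} => g i).
Proof. by move=> f; have /ptws_cvgP := (@cvg_id _ (nbhs f)); exact. Qed.

Lemma val_continuous (X : topologicalType) (A : set X) :
  continuous (fun x : A => \val x).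
Proof. exact: initial_continuous. Qed.

Lemma subtype_continuousP (X Z : topologicalType) (A : set X) (f : Z -> A) z :
  {for z, continuous f} <-> {for z, continuous (fun y => \val (f y))}.
Proof.
split=> [cf|cf]; first by apply: continuous_comp cf _; exact: val_continuous.
move=> N [B /= [[C oC <-] Cf] BN]; apply: filterS BN _.
by apply: cf; exact: open_nbhs_nbhs.
Qed.

Lemma pair_continuous (X Y Z : topologicalType) (f : Z -> X) (g : Z -> Y) z :
  {for z, continuous f} -> {for z, continuous g} ->
  {for z, continuous (fun y => (f y, g y))}.
Proof. by move=> cf cg; exact: (cvg_pair cf cg). Qed.

Lemma nbhs_subtype_open (X : topologicalType) (U : set X) (u : U) (N : set U) :
  open U -> nbhs u N -> nbhs (\val u) [set x | exists2 v : U, N v & \val v = x].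
Proof.
move=> oU [B /= [[C oC <-] Cf] BN].
apply: (filterS _ (open_nbhs_nbhs (conj (openI oC oU) _))); last first.
  by split=> //; exact: set_valP.
move=> x [Cx /mem_set Ux]; exists (exist _ x Ux) => //; exact: BN.
Qed.

Section LocalSections.
Context {R : realType}.
Notation I01 := (unit_interval R).

Lemma clamp_subproof (t : R) : Num.max 0 (Num.min t 1) \in I01.
Proof.
rewrite inE /unit_interval /= in_itv /= le_max lexx /= ge_max ler01 /=.
by rewrite ge_min lexx orbT.
Qed.

Definition clamp (t : R) : I01 := exist _ (Num.max 0 (Num.min t 1))
  (clamp_subproof t).

Lemma clamp_val (t : I01) : clamp (\val t) = t.
Proof.
apply: val_inj => /=; have := set_mem (valP t).
rewrite /unit_interval /= in_itv /= => /andP[t0 t1].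
by rewrite (min_idPl t1) (max_idPr t0).
Qed.

Lemma clamp_continuous : continuous clamp.
Proof.
move=> t; apply/subtype_continuousP => /=.
apply: continuous_max; first exact: cst_continuous.
by apply: continuous_min; [exact: cvg_id|exact: cst_continuous].
Qed.

Lemma unit_interval_compact : compact [set: I01].
Proof.
have -> : [set: I01] = clamp @` `[0, 1].
  apply/seteqP; split=> // t _; exists (\val t); last exact: clamp_val.
  exact: (set_valP t).
apply: continuous_compact; last exact: segment_compact.
by apply: continuous_subspaceT; exact: clamp_continuous.
Qed.

Context {s : nat} {X : topologicalType}.
Notation Xs := {ptws 'I_s -> X}.

(** Compactness of the interval makes evaluation jointly continuous, so a section becomes a map in
    two variables. Clamping extends it to all times, and openness of [U] gives continuity in the
    ambient space. *)
Lemma local_section_uncurry (U : set Xs)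
  (x0 : X) : open U -> has_local_section R U ->
  exists G : Xs * R -> X,
    (forall u t, U u -> {for (u, t), continuous G}) /\
    (forall u (k : 'I_s), U u -> G (u, k%:R / s.-1%:R) = u k).
Proof.
move=> oU [sg [csg esg]].
pose f (u : U) : I01 -> X := \val (sg u).
have cf : continuous (f : U -> {compact-open, I01 -> X}).
  by move=> u; apply: (@continuous_comp _ _ _ sg (fun g => \val g));
    [exact: csg|exact: val_continuous].
have cfu u : continuous (f u) := set_valP (sg u).
have lc : locally_compact [set: I01].
  move=> t _; rewrite withinET; exists setT; first exact: filterT.
  by split; [exact: unit_interval_compact|exact: closedT].
have cunf : continuous (uncurry f).
  exact: (@continuous_uncurry_regular _ _ _ f lc uniform_regular cf cfu).
pose G (p : Xs * R) : X :=
  if pselect (U p.1) is left Up then f (exist _ p.1 (mem_set Up))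
    (clamp p.2) else x0.
have GE (u : U) t : G (\val u, t) = uncurry f (u, clamp t).
  rewrite /G /=; case: pselect => [Up|[]]; last by exact: set_valP.
  by rewrite (_ : exist _ _ _ = u) //; exact: val_inj.
exists G; split=> [u t Uu N|u k Uu].
  rewrite -[u]/(\val (exist _ u (mem_set Uu) : U)); move: (exist _ _ _) => {Uu}u.
  rewrite GE => /cunf [[A B] /= [Au Bt] ABN].
  exists ([set x | exists2 v : U, A v & \val v = x], clamp @^-1` B).
    by split=> /=; [exact: nbhs_subtype_open|exact: clamp_continuous].
  by move=> [_ r] /= [[v Av <-] Br]; rewrite GE; exact: (ABN (v, clamp r)).
rewrite -[u]/(\val (exist _ u (mem_set Uu) : U)); move: (exist _ _ _) => {Uu}u.
rewrite GE -esg /path_eval -(clamp_val (sample_time _ _)).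
by [].
Qed.

Lemma local_section_curry (U : set Xs) (G : Xs * R -> X) : open U ->
  (forall u t, U u -> {for (u, t), continuous G}) ->
  (forall u (k : 'I_s), U u -> G (u, k%:R / s.-1%:R) = u k) ->
  has_local_section R U.
Proof.
move=> oU cG eG.
pose g (p : U * I01) : X := G (\val p.1, \val p.2).
have cg : continuous g.
  move=> [u t]; apply: (@continuous_comp _ _ _
    (fun p : U * I01 => (\val p.1 : Xs, \val p.2 : R))).
    apply: pair_continuous.
      apply: (@continuous_comp _ _ _ (fun p : U * I01 => p.1)
        (fun x : U => \val x)).
        exact: cvg_fst.
      exact: val_continuous.
    apply: (@continuous_comp _ _ _ (fun p : U * I01 => p.2)
      (fun x : I01 => \val x)).
      exact: cvg_snd.
    exact: val_continuous.
  by apply: cG; exact: (set_valP u).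
have [cc cu] := continuous_curry cg.
have pg u : curry g u \in @path_space R X by apply/mem_set/cu.
exists (fun u => exist _ (curry g u) (pg u)); split.
  by move=> u; apply/subtype_continuousP; exact: cc.
by move=> u; apply/funext => k; rewrite /path_eval /= /curry /g /= eG //;
  exact: (set_valP u).
Qed.

End LocalSections.

(** * Homotopies *)

Lemma near_eq_continuous (Y X : topologicalType) (f g : Y -> X) y :
  (\forall z \near y, g z = f z) -> {for y, continuous g} -> {for y, continuous f}.
Proof.
move=> gf cg N; rewrite -(nbhs_singleton gf) => /cg; apply: filterS2 gf.
by move=> z /= ->.
Qed.

Lemma near_fst (Y Z : topologicalType) (y : Y) (z : Z) (Q : set Y) :
  (\forall y' \near y, Q y') -> \forall p \near (y, z), Q p.1.
Proof. by move=> Qy; exists (Q, setT) => [|p []//]; split=> //; exact: filterT. Qed.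

Lemma near_snd (Y Z : topologicalType) (y : Y) (z : Z) (Q : set Z) :
  (\forall z' \near z, Q z') -> \forall p \near (y, z), Q p.2.
Proof. by move=> Qz; exists (setT, Q) => [|p []//]; split=> //; exact: filterT. Qed.

Section Homotopy.
Context {R : realType} {Y X : topologicalType}.
Implicit Types (P : set Y) (f g h : Y -> X).

(** Time runs over the whole line, constantly outside the interval, and continuity is asked in
    [Y * R]; this avoids subtypes when homotopies are reparametrised and glued. *)
Definition homotopic_on P f g := exists H : Y * R -> X,
  [/\ forall y t, P y -> {for (y, t), continuous H},
      forall y t, P y -> t <= 0 -> H (y, t) = f y &
      forall y t, P y -> 1 <= t -> H (y, t) = g y].

Lemma homotopic_on_trans P f g h :
  homotopic_on P f g -> homotopic_on P g h -> homotopic_on P f h.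
Proof.
move=> [H [cH H0 H1]] [K [cK K0 K1]].
pose A (p : Y * R) := H (p.1, 2 * p.2).
pose B (p : Y * R) := K (p.1, 2 * p.2 - 1).
have c2 (z : Y * R) : {for z, continuous (fun p : Y * R => 2 * p.2 : R)}.
  by apply: continuousM; [exact: cst_continuous|exact: cvg_snd].
have cA y t : P y -> {for (y, t), continuous A}.
  move=> Py; apply: (@continuous_comp _ _ _ (fun p : Y * R => (p.1, 2 * p.2)));
    last exact: cH.
  by apply: pair_continuous; [exact: cvg_fst|exact: c2].
have cB y t : P y -> {for (y, t), continuous B}.
  move=> Py; apply: (@continuous_comp _ _ _
    (fun p : Y * R => (p.1, 2 * p.2 - 1))); last exact: cK.
  apply: pair_continuous; first exact: cvg_fst.
  by apply: continuousB; [exact: c2|exact: cst_continuous].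
exists (fun p => if 2 * p.2 < 1 then A p else B p); split => /=.
- move=> y t Py; have [t1|t1|t1] := ltgtP (2 * t) 1.
  + apply: near_eq_continuous (cA y t Py).
    have : \forall p \near (y, t), 2 * p.2 < 1 :> R.
      by apply: (c2 (y, t) [set r | r < 1]); exact: lt_nbhsl.
    by apply: filterS => p ->.
  + apply: near_eq_continuous (cB y t Py).
    have : \forall p \near (y, t), 1 < 2 * p.2 :> R.
      by apply: (c2 (y, t) [set r | 1 < r]); exact: lt_nbhsr.
    by apply: filterS => p p1; rewrite ltNge (ltW p1).
  (* At the seam [t = 1/2] both formulas agree and are continuous, so either branch lands in [N]
     nearby. *)
  + have AB : A (y, t) = B (y, t) by rewrite /A /B /= t1 subrr H1 // K0.
    move=> N /=; rewrite t1 ltxx => BN.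
    have AN : nbhs (A (y, t)) N by rewrite AB.
    have nA : \forall p \near (y, t), N (A p) := cA y t Py N AN.
    have nB : \forall p \near (y, t), N (B p) := cB y t Py N BN.
    by apply: filterS2 nA nB => p pA pB /=; case: ifP.
- by move=> y t Py t0; rewrite ifT ?/A /= ?H0 //; lra.
- by move=> y t Py t0; rewrite ifF ?/B /= ?K1 //; lra.
Qed.

(** As [g] is locally constant on [P], a homotopy to [h] can be chosen separately for each value of
    [g]; the choices assemble continuously. *)
Lemma homotopic_on_glue P f g h :
  (forall y, P y -> \forall z \near y, P z /\ g z = g y) ->
  homotopic_on P f g ->
  (forall x, homotopic_on P (fun=> x) h) ->
  homotopic_on P f h.
Proof.
move=> gP fg /choice[K cK]; apply: homotopic_on_trans fg _.
exists (fun p => K (g p.1) p); split.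
- move=> y t Py; have [cKy _ _] := cK (g y).
  apply: near_eq_continuous (cKy y t Py).
  have : \forall p \near (y, t), P p.1 /\ g p.1 = g y.
    by apply: (@near_fst _ _ _ _ [set z | P z /\ g z = g y]); exact: gP.
  by apply: filterS => p [_ ->].
- by move=> y t Py t0 /=; have [_ -> //] := cK (g y).
- by move=> y t Py t0 /=; have [_ _ -> //] := cK (g y).
Qed.

End Homotopy.

Section PathFromHomotopies.
Context {R : realType} {s : nat} {X : topologicalType}.
Notation Xs := {ptws 'I_s -> X}.

(* Near time [k / (s-1)] run the homotopy [h_k] backwards and forwards, so that
   all pieces meet at the common end point [x0]. *)
Lemma local_section_of_homotopies (U : set Xs) (x0 : X) : (1 < s)%N -> open U ->
  (forall k : 'I_s, @homotopic_on R _ _ U (fun u => u k) (fun=> x0)) ->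
  has_local_section R U.
Proof.
move=> s1 oU /choice[h hP].
(* [lam k t] is 0 at the [k]-th sample time and below 1 exactly within half a sampling step of it;
   the factor 2 makes these windows disjoint. *)
pose lam (k : 'I_s) (t : R) : R := 2 * `|s.-1%:R * t - k%:R|.
have clam k : continuous (lam k).
  move=> t; change {for t, continuous (fun r : R => 2 * `|s.-1%:R * r - k%:R| : R)}.
  apply: continuousM; first exact: cst_continuous.
  apply: (@continuous_comp _ _ _ (fun r : R => s.-1%:R * r - k%:R) Num.norm).
    apply: continuousB; last exact: cst_continuous.
    by apply: continuousM; [exact: cst_continuous|exact: cvg_id].
  exact: norm_continuous.
pose h' k (p : Xs * R) := h k (p.1, lam k p.2).
have ch k u t : U u -> {for (u, t), continuous (h' k)}.
  move=> Uu; apply: (@continuous_comp _ _ _ (fun p : Xs * R => (p.1, lam k p.2))).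
    apply: pair_continuous; first exact: cvg_fst.
    by apply: (@continuous_comp _ _ _ (fun p : Xs * R => p.2) (lam k));
      [exact: cvg_snd|exact: clam].
  by have [+ _ _] := hP k; exact.
have uniq_lam k k' t : lam k t < 1 -> lam k' t < 1 -> k = k'.
  wlog kk : k k' / (k <= k')%N => [hw|].
    by case/orP: (leq_total k k') => [/hw|/hw H ? ?]; [exact|exact/esym/H].
  rewrite /lam => l1 l2; apply/val_inj/eqP; rewrite eqn_leq kk /= leqNgt.
  apply/negP => /= lt; have : k%:R + 1 <= k'%:R :> R by rewrite natr1 ler_nat.
  move: l1 l2; set y := s.-1%:R * t; move: (k%:R : R) (k'%:R : R) => c d.
  have := ler_norm (y - c); have := ler_norm (- (y - d)); rewrite normrN.
  move: (`|y - c|) (`|y - d|) => e e' *; lra.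
pose G (p : Xs * R) := if [pick k | lam k p.2 < 1] is Some k then h' k p else x0.
have GE k u t : lam k t < 1 -> G (u, t) = h' k (u, t).
  rewrite /G /= => kt; case: pickP => [k' k't|/(_ k)]; last by rewrite kt.
  by rewrite (uniq_lam _ _ _ kt k't).
apply: (@local_section_curry _ _ _ U G) => //.
  move=> u t Uu; have [[k kt]|nk] := pselect (exists k, lam k t < 1).
    apply: near_eq_continuous (ch k u t Uu).
    have : \forall p \near (u, t), lam k p.2 < 1.
      apply: (@near_snd _ _ _ _ [set r | lam k r < 1]).
      by apply: (clam k t [set r | r < 1]); exact: lt_nbhsl.
    by apply: filterS => -[v r] /= /GE ->.
  have Gx : G (u, t) = x0.
    by rewrite /G; case: pickP => // k kt; case: nk; exists k.
  (* Outside the open windows every [h' k] has the value [x0], so whichever branch [G] takes nearby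
     stays in [N]. *)
  move=> N; rewrite Gx => xN.
  have hN k : \forall p \near (u, t), N (h' k p).
    apply: (ch k u t Uu N); have [_ _ hE] := hP k; rewrite /h' /= hE //.
    by rewrite leNgt; apply/negP => kt; apply: nk; exists k.
  have hN' : \forall p \near (u, t), forall k, N (h' k p) by refine
    (@filter_forall _ _ (fun k p => N (h' k p)) (nbhs (u, t)) _ hN).
  apply: (@filterS _ (nbhs (u, t)) _ _ _ _ hN') => -[v r] /= Nk.
  rewrite /G; case: pickP => // _; exact: nbhs_singleton xN.
move=> u k Uu; have lk : lam k (k%:R / s.-1%:R) = 0.
  rewrite /lam [s.-1%:R * _]mulrC divfK ?subrr ?normr0 ?mulr0 // pnatr_eq0 -lt0n.
  by case: (s) s1 => [|[]].
rewrite (GE k) ?lk ?ltr01 // /h' /= lk; have [_ -> //] := hP k.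
Qed.

End PathFromHomotopies.

(** * Sliding points on the circle *)

Section Circle.
Context {R : realType}.
Notation S1 := (circle R).
Implicit Types (p q : S1) (v w : R * R) (t : R).

Definition px p : R := (\val p).1.
Definition py p : R := (\val p).2.

Lemma circleE p : px p ^+ 2 + py p ^+ 2 = 1.
Proof. exact: (set_valP p). Qed.

Lemma circle_eq p q : px p = px q -> py p = py q -> p = q.
Proof. by move=> E1 E2; apply: val_inj; apply: injective_projections. Qed.

Lemma px_continuous : continuous px.
Proof.
move=> p; apply: (@continuous_comp _ _ _ (fun q : S1 => \val q) fst).
  exact: val_continuous.
exact: cvg_fst.
Qed.

Lemma py_continuous : continuous py.
Proof.
move=> p; apply: (@continuous_comp _ _ _ (fun q : S1 => \val q) snd).
  exact: val_continuous.
exact: cvg_snd.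
Qed.

Lemma circle_continuousP (Z : topologicalType) (f : Z -> S1) z :
  {for z, continuous (fun y => px (f y))} ->
  {for z, continuous (fun y => py (f y))} -> {for z, continuous f}.
Proof.
move=> c1 c2; apply/subtype_continuousP.
rewrite (_ : (fun y => \val (f y)) = (fun y => (px (f y), py (f y)))).
  exact: pair_continuous.
by apply/funext => y; rewrite /px /py; case: (\val (f y)).
Qed.

Definition dot p q : R := px p * px q + py p * py q.

Lemma dotpp p : dot p p = 1.
Proof. by rewrite /dot -!expr2 circleE. Qed.

(** The squared length of [p + q] is [2 + 2 * dot p q], which is positive unless the points are
    antipodal. *)
Lemma dot_gtN1 p q : (px q != - px p) || (py q != - py p) -> -1 < dot p q.
Proof.
rewrite /dot; have := circleE p; have := circleE q.
move: (px p) (py p) (px q) (py q) => a b c d h1 h2 h.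
have : 0 < (a + c) ^+ 2 + (b + d) ^+ 2.
  case/orP: h => h.
    rewrite ltr_pwDl ?sqr_ge0 // exprn_even_gt0 //=.
    by apply: contra h => /eqP h; apply/eqP; lra.
  rewrite ltr_wpDl ?sqr_ge0 // exprn_even_gt0 //=.
  by apply: contra h => /eqP h; apply/eqP; lra.
by move=> ?; nra.
Qed.

Definition norm2 v : R := Num.sqrt (v.1 ^+ 2 + v.2 ^+ 2).

Lemma unit_vector_subproof v : 0 < v.1 ^+ 2 + v.2 ^+ 2 ->
  (v.1 / norm2 v, v.2 / norm2 v) \in circle R.
Proof.
move=> v0; rewrite inE /circle /= !expr_div_n -mulrDl sqr_sqrtr ?ltW //.
by rewrite divff ?gt_eqF.
Qed.

(* The default value [p] is only taken at [v = 0]. *)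
Definition direction p v : S1 := insubd p (v.1 / norm2 v, v.2 / norm2 v).

Lemma val_direction p v : 0 < v.1 ^+ 2 + v.2 ^+ 2 ->
  \val (direction p v) = (v.1 / norm2 v, v.2 / norm2 v).
Proof. by move=> v0; rewrite /direction val_insubd ifT //;
  exact: unit_vector_subproof. Qed.

Definition unit_clamp t : R := Num.max 0 (Num.min t 1).

Lemma unit_clamp_continuous : continuous unit_clamp.
Proof.
move=> t; change {for t, continuous (fun r : R => Num.max 0 (Num.min r 1))}.
apply: continuous_max; first exact: cst_continuous.
by apply: continuous_min; [exact: cvg_id|exact: cst_continuous].
Qed.

Lemma unit_clamp_itv t : 0 <= unit_clamp t <= 1.
Proof. by rewrite le_max lexx /= ge_max ler01 /= ge_min lexx orbT. Qed.

Definition segment p q t : R * R :=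
  let c := unit_clamp t in
  ((1 - c) * px p + c * px q, (1 - c) * py p + c * py q).

(** Radial projection of the straight segment. Between equal points it is constant ([slide_id]),
    which holds the anchors in place. *)
Definition slide p q t : S1 := direction p (segment p q t).

Lemma segment_neq0 p q t : -1 < dot p q ->
  0 < (segment p q t).1 ^+ 2 + (segment p q t).2 ^+ 2.
Proof.
rewrite /segment /dot /=; have := circleE p; have := circleE q.
have := unit_clamp_itv t; move: (unit_clamp t) (px p) (py p) (px q) (py q).
move=> c a b a' b' /andP[c0 c1] h1 h2 h.
have E : ((1 - c) * a + c * a') ^+ 2 + ((1 - c) * b + c * b') ^+ 2 =
  (1 - c) ^+ 2 * (a ^+ 2 + b ^+ 2) + c ^+ 2 * (a' ^+ 2 + b' ^+ 2) +
  2 * (c * (1 - c)) * (a * a' + b * b') by ring.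
rewrite E h1 h2 !mulr1; have cc : 0 <= c * (1 - c) by apply: mulr_ge0; lra.
have [c2|c2] := eqVneq (c * (1 - c)) 0.
  rewrite c2 mulr0 mul0r addr0; have : c ^+ 2 = c by lra.
  by move=> c3; rewrite c3; nra.
have {}cc : 0 < c * (1 - c) by rewrite lt_neqAle eq_sym c2.
move: h; set d := _ + _ => h; have hd : 0 < c * (1 - c) * (1 + d) by apply:
  mulr_gt0 => //; lra.
rewrite [X in 0 < X](_ : _ = (1 - 2 * c) ^+ 2 + 2 * (c * (1 - c) * (1 + d)));
  last by ring.
by have := sqr_ge0 (1 - 2 * c); lra.
Qed.

Lemma direction_continuous (Z : topologicalType) (f : Z -> S1) (g : Z -> R * R) z :
  0 < (g z).1 ^+ 2 + (g z).2 ^+ 2 ->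
  {for z, continuous (fun y => (g y).1)} -> {for z, continuous
    (fun y => (g y).2)} ->
  {for z, continuous (fun y => direction (f y) (g y))}.
Proof.
move=> gz c1 c2.
pose N y := (g y).1 * (g y).1 + (g y).2 * (g y).2.
have NE y : N y = (g y).1 ^+ 2 + (g y).2 ^+ 2 by rewrite !expr2.
rewrite -NE in gz.
have cN : {for z, continuous N} by apply: continuousD; apply: continuousM.
have cr : {for z, continuous (fun y => (Num.sqrt (N y))^-1)}.
  apply: continuousV; first by rewrite gt_eqF // sqrtr_gt0.
  by apply: continuous_comp => //; exact: sqrt_continuous.
have nN : \forall y \near z, 0 < N y.
  by apply: (cN [set r | 0 < r]); exact: lt_nbhsr.
apply: circle_continuousP.
  apply: near_eq_continuous (continuousM c1 cr).
  by apply: filterS nN => y; rewrite NE => Ny; rewrite /px val_direction // NE.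
apply: near_eq_continuous (continuousM c2 cr).
by apply: filterS nN => y; rewrite NE => Ny; rewrite /py val_direction // NE.
Qed.

Lemma slide_continuous (Z : topologicalType) (f g : Z -> S1) (h : Z -> R) z :
  -1 < dot (f z) (g z) ->
  {for z, continuous f} -> {for z, continuous g} -> {for z, continuous h} ->
  {for z, continuous (fun y => slide (f y) (g y) (h y))}.
Proof.
move=> fg cf cg ch.
have cc : {for z, continuous (fun y => unit_clamp (h y))}.
  by apply: continuous_comp => //; exact: unit_clamp_continuous.
have c1c : {for z, continuous (fun y => 1 - unit_clamp (h y))}.
  by apply: continuousB => //; exact: cst_continuous.
have cx (k : Z -> S1) : {for z, continuous k} -> {for z, continuous
  (fun y => px (k y))}.
  by move=> ck; apply: (@continuous_comp _ _ _ k px) => //; exact: px_continuous.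
have cy (k : Z -> S1) : {for z, continuous k} -> {for z, continuous
  (fun y => py (k y))}.
  by move=> ck; apply: (@continuous_comp _ _ _ k py) => //; exact: py_continuous.
apply: direction_continuous; first exact: segment_neq0.
  exact: continuousD (continuousM c1c (cx f cf)) (continuousM cc (cx g cg)).
exact: continuousD (continuousM c1c (cy f cf)) (continuousM cc (cy g cg)).
Qed.

Lemma direction_unit p q v : v.1 = px q -> v.2 = py q -> direction p v = q.
Proof.
move=> v1 v2; have v0 : v.1 ^+ 2 + v.2 ^+ 2 = 1 by rewrite v1 v2 circleE.
by apply: val_inj; rewrite val_direction /norm2 v0 ?ltr01 // sqrtr1 !divr1 v1 v2
  /px /py; case: (\val q).
Qed.

Lemma slide_le0 p q t : t <= 0 -> slide p q t = p.
Proof.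
move=> t0; have -> : slide p q t = direction p (segment p q 0).
  rewrite /slide /segment /unit_clamp; congr direction.
  by rewrite !min_l ?(max_idPl t0) ?maxxx //; lra.
by apply: direction_unit; rewrite /segment /unit_clamp /= min_l ?ler01 // maxxx
  subr0 mul1r mul0r addr0.
Qed.

Lemma slide_ge1 p q t : 1 <= t -> slide p q t = q.
Proof.
move=> t1; apply: direction_unit;
by rewrite /segment /unit_clamp /= min_r // max_r ?ler01 // subrr mul0r mul1r add0r.
Qed.

Lemma slide_id p t : slide p p t = p.
Proof. by apply: direction_unit; rewrite /segment /= -mulrDl subrK mul1r. Qed.

Lemma rot_subproof p : (- py p, px p) \in circle R.
Proof. by rewrite inE /circle /= sqrrN addrC circleE. Qed.

Definition quarter_turn p : S1 := exist _ (- py p, px p) (rot_subproof p).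

(* A point that is antipodal neither to [p] nor to [q]. *)
Definition midway p q : S1 := if -1 < dot p q then p else quarter_turn p.

Lemma midwaypp p : midway p p = p.
Proof. by rewrite /midway dotpp ifT //; lra. Qed.

Lemma dot_midwayl p q : -1 < dot p (midway p q).
Proof.
rewrite /midway; case: ifP => // _; first by rewrite dotpp; lra.
suff -> : dot p (quarter_turn p) = 0 by lra.
by rewrite /dot /px /py /=; ring.
Qed.

Lemma dot_midwayr p q : -1 < dot (midway p q) q.
Proof.
rewrite /midway; case: ifP => // /negbT; apply: contraR => h.
apply: dot_gtN1; apply: contraR h; rewrite negb_or !negbK => /andP[/eqP q1 /eqP q2].
suff -> : dot (quarter_turn p) q = 0 by lra.
by rewrite /dot q1 q2 /px /py /=; ring.
Qed.

End Circle.

(** * The two arcs cut out by the anchors *)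

Section Anchors.
Context {R : realType}.
Notation S1 := (circle R).
Variables a b : S1.
Hypothesis ab : a <> b.
Implicit Types (p q : S1).

Let w1 := px b - px a.
Let w2 := py b - py a.
Let ww := w1 ^+ 2 + w2 ^+ 2.

(* A linear function whose sign tells the two arcs cut out by [a] and [b]. *)
Definition chord p : R := w1 * (py p - py a) - w2 * (px p - px a).

(** Scalar product with [b - a]. The circle being centred at the origin, [a] and [b] have opposite
    values. *)
Definition along p : R := w1 * px p + w2 * py p.

Lemma ww_gt0 : 0 < ww.
Proof.
rewrite lt_neqAle addr_ge0 ?sqr_ge0 // andbT eq_sym paddr_eq0 ?sqr_ge0 //.
rewrite !sqrf_eq0 !subr_eq0; apply/negP => /andP[/eqP E1 /eqP E2].
by apply: ab; apply: circle_eq.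
Qed.

Lemma chorda : chord a = 0. Proof. by rewrite /chord !subrr !mulr0 subrr. Qed.

Lemma chordb : chord b = 0. Proof. by rewrite /chord -/w1 -/w2 mulrC subrr. Qed.

Lemma alonga : along a = - (ww / 2).
Proof.
rewrite /along /ww /w1 /w2; have := circleE a; have := circleE b => h1 h2.
lra.
Qed.

Lemma alongb : along b = ww / 2.
Proof.
rewrite /along /ww /w1 /w2; have := circleE a; have := circleE b => h1 h2.
lra.
Qed.

Lemma chord_continuous : continuous chord.
Proof.
move=> p; change {for p, continuous (fun p =>
  w1 * (py p - py a) - w2 * (px p - px a))}.
apply: continuousB; apply: continuousM; try exact: cst_continuous.
  by apply: continuousB; [exact: py_continuous|exact: cst_continuous].
by apply: continuousB; [exact: px_continuous|exact: cst_continuous].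
Qed.

Lemma along_continuous : continuous along.
Proof.
move=> p; change {for p, continuous (fun p => w1 * px p + w2 * py p)}.
apply: continuousD; apply: continuousM; try exact: cst_continuous.
  exact: px_continuous.
exact: py_continuous.
Qed.

Let nrm : R := Num.sqrt ww.
Let ca : R := w1 * py a - w2 * px a.

(** [nrm] is the length of the chord and [ca] the cross product of [b - a] with [a]. By
    [along_decomp], [|chord|] is at least [nrm - |ca|] where [along] vanishes; half of this bounds a
    band without zeros of [along]. *)
Definition chord_radius : R := (nrm - `|ca|) / 2.

Lemma nrm2 : nrm ^+ 2 = ww.
Proof. by rewrite sqr_sqrtr // ltW // ww_gt0. Qed.

Lemma nrm_gt0 : 0 < nrm.
Proof. by rewrite sqrtr_gt0 ww_gt0. Qed.

Lemma along_decomp p : (chord p + ca) ^+ 2 + along p ^+ 2 = nrm ^+ 2.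
Proof.
rewrite nrm2 /ww -[RHS]mulr1 -(circleE p) /chord /along /ca; ring.
Qed.

Lemma ca_lt : `|ca| < nrm.
Proof.
have := along_decomp a; rewrite chorda add0r alonga => E.
rewrite -(ltr_pXn2r (n := 2)) ?nnegrE ?normr_ge0 ?(ltW nrm_gt0) // -E.
rewrite real_normK ?num_real // ltrDl exprn_even_gt0 //= oppr_eq0.
by rewrite gt_eqF // divr_gt0 // ww_gt0.
Qed.

Lemma chord_radius_gt0 : 0 < chord_radius.
Proof. by rewrite divr_gt0 // subr_gt0 ca_lt. Qed.

Lemma along_neq0 p : `|chord p| <= chord_radius -> along p != 0.
Proof.
move=> h; apply/negP => /eqP al; have := along_decomp p.
rewrite al expr0n addr0 => E.
have : `|chord p + ca| = nrm.
  by apply/eqP; rewrite -(eqrXn2 (n := 2)) ?(ltW nrm_gt0) // real_normK ?num_real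
    // E.
have := ler_normD (chord p) ca; have := ca_lt; rewrite /chord_radius in h.
by move=> *; lra.
Qed.

Definition arc_mid (sgn : R) : S1 := direction a (sgn * - w2, sgn * w1).

Lemma arc_midE sgn : sgn ^+ 2 = 1 ->
  px (arc_mid sgn) = sgn * - w2 / nrm /\ py (arc_mid sgn) = sgn * w1 / nrm.
Proof.
move=> s2; have E : (sgn * - w2) ^+ 2 + (sgn * w1) ^+ 2 = ww.
  by rewrite !exprMn s2 !mul1r sqrrN addrC.
by rewrite /px /py val_direction /norm2 /= E ?ww_gt0.
Qed.

(** The scalar product is [sgn * (chord p + ca) / nrm], hence above [- |ca| / nrm], which exceeds -1
    by [ca_lt]. *)
Lemma dot_arc_mid sgn p : sgn ^+ 2 = 1 -> 0 < sgn * chord p ->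
  -1 < dot p (arc_mid sgn).
Proof.
move=> s2 cp; have [E1 E2] := arc_midE s2; rewrite /dot E1 E2.
rewrite [X in _ < X](_ : _ = sgn * (chord p + ca) / nrm);
  last by rewrite /chord /ca; ring.
rewrite ltr_pdivlMr ?nrm_gt0 // mulrDr mulN1r.
have h1 : - `|ca| <= sgn * ca.
  have -> : `|ca| = `|sgn * ca|.
    rewrite normrM (_ : `|sgn| = 1) ?mul1r //.
    by apply/eqP; rewrite -(eqrXn2 (n := 2)) ?ler01 // real_normK ?num_real // s2
      expr1n.
  by rewrite lerNl -normrN ler_norm.
by have := ca_lt; lra.
Qed.

(** Points beyond height [rho] go to the middle of their arc, points in the band to the anchor on
    their side of the line [along = 0]. *)
Definition target (rho : R) p : S1 :=
  if rho < chord p then arc_mid 1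
  else if chord p < - rho then arc_mid (-1)
  else if along p < 0 then a else b.

Section Target.
Variable rho : R.
Hypothesis rho0 : 0 < rho.
Hypothesis rho_le : rho <= chord_radius.

Lemma targeta : target rho a = a.
Proof.
have h := ww_gt0; rewrite /target chorda alonga.
by rewrite (le_gtF (ltW rho0)) le_gtF ?oppr_le0 ?ltW // oppr_lt0 divr_gt0.
Qed.

Lemma targetb : target rho b = b.
Proof.
have h := ww_gt0; rewrite /target chordb alongb.
by rewrite (le_gtF (ltW rho0)) !le_gtF ?oppr_le0 ?ltW // divr_gt0.
Qed.

(** In the band, [p] and its target have [along] of the same sign, while antipodal points have
    opposite values. *)
Lemma dot_target p : -1 < dot p (target rho p).
Proof.
have r0 := rho0; have rl := rho_le.
rewrite /target; have [c1|c1] := ltP rho (chord p); first by apply: dot_arc_mid;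
  rewrite ?expr1n // mul1r; lra.
have [c2|c2] := ltP (chord p) (- rho); first by apply: dot_arc_mid;
  rewrite ?sqrrN ?expr1n //; lra.
have /along_neq0 al : `|chord p| <= chord_radius by rewrite ler_norml;
  apply/andP; split; lra.
have opp q : along q != - along p -> -1 < dot p q.
  move=> h; apply: dot_gtN1; apply: contraR h; rewrite negb_or !negbK.
  by move=> /andP[/eqP E1 /eqP E2]; rewrite /along E1 E2 !mulrN opprD.
have [a1|a1] := ltP (along p) 0; apply: opp; rewrite ?alonga ?alongb;
  have := ww_gt0 => *.
  by apply/eqP; lra.
have {al} : 0 < along p by rewrite lt_neqAle eq_sym al.
by move=> ?; apply/eqP; lra.
Qed.

(** [target] can jump only where [|chord|] equals [rho], which is excluded, or where [along]
    vanishes in the band, which [along_neq0] forbids. *)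
Lemma target_locally_constant p : `|chord p| != rho ->
  \forall q \near p, `|chord q| != rho /\ target rho q = target rho p.
Proof.
move=> cp; have r0 := rho0; have rl := rho_le; have cc := @chord_continuous p;
  have ca' := @along_continuous p.
have [c1|c1] := ltP rho (chord p).
  have : \forall q \near p, rho < chord q.
    by apply: (cc [set r | rho < r]); exact: lt_nbhsr.
  apply: filterS => q c1'; split; last by rewrite /target c1 c1'.
  by rewrite gt_eqF // (lt_le_trans c1') // ler_norm.
have [c2|c2] := ltP (chord p) (- rho).
  have : \forall q \near p, chord q < - rho.
    by apply: (cc [set r | r < - rho]); exact: lt_nbhsl.
  apply: filterS => q c2'; split.
    by rewrite gt_eqF // -normrN (lt_le_trans _ (ler_norm _)) // ltrNr.
  by rewrite /target c2 c2' !ifF //; apply/negbTE; rewrite -leNgt; lra.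
have cpr : `|chord p| < rho by rewrite lt_neqAle cp ler_norml c1 c2.
have near_chord : \forall q \near p, `|chord q| < rho.
  have : {for p, continuous (fun q => `|chord q|)}.
    by apply: continuous_comp => //; exact: norm_continuous.
  by move=> /(_ [set r | r < rho]); apply; exact: lt_nbhsl.
have near_along : \forall q \near p, (along q < 0) = (along p < 0).
  have /along_neq0 : `|chord p| <= chord_radius by rewrite (le_trans (ltW cpr)).
  case: ltgtP => // a0 _.
    have : \forall q \near p, along q < 0.
      by apply: (ca' [set r | r < 0]); exact: lt_nbhsl.
    by apply: filterS.
  have : \forall q \near p, 0 < along q.
    by apply: (ca' [set r | 0 < r]); exact: lt_nbhsr.
  by apply: filterS => q q0; rewrite ltNge ltW.
apply: filterS2 near_chord near_along => q qc qa; split; first by rewrite lt_eqF.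
move: qc cpr; rewrite !ltr_norml => /andP[q1 q2] /andP[p1 p2].
have low r : r < rho -> (rho < r) = false by move=> ?; apply/negbTE;
  rewrite -leNgt ltW.
have up r : - rho < r -> (r < - rho) = false by move=> ?; apply/negbTE;
  rewrite -leNgt ltW.
by rewrite /target qa !low ?up.
Qed.

End Target.

End Anchors.

(** * The upper bound *)

Section AnchoredConf.
Context {R : realType} {n : nat}.
Notation S1 := (circle R).
Variables a b : S1.
Notation X := (anchored_conf R n [set a; b]).

Definition coord (x : X) (i : 'I_n) : S1 := (\val x : {ptws 'I_n -> S1}) i.

Lemma conf_eq (x y : X) : coord x =1 coord y -> x = y.
Proof. by move=> xy; apply: val_inj; apply/funext. Qed.

Lemma conf_coord_continuous i : continuous (fun x : X => coord x i).
Proof.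
move=> x; apply: (@continuous_comp _ _ _ (fun x : X => \val x)
  (fun g : {ptws 'I_n -> S1} => g i)).
  exact: val_continuous.
exact: ptws_eval_continuous.
Qed.

Lemma coord_anchors (x : X) : (exists i, coord x i = a) /\ (exists j, coord x j =
  b).
Proof.
have xab := set_valP x.
have [|i _ ia] := xab a; first by left.
have [|j _ jb] := xab b; first by right.
by split; [exists i|exists j].
Qed.

Lemma anchors_conf (f : {ptws 'I_n -> S1}) i j : f i = a -> f j = b -> f \in X.
Proof. by move=> fi fj; apply/mem_set => _ [->|->]; [exists i|exists j]. Qed.

Definition conf_of (f : {ptws 'I_n -> S1}) i j (fi : f i = a) (fj : f j = b) : X :=
  exist _ f (anchors_conf fi fj).

(** Sliding every coordinate stays in the anchored space: some coordinate sits at [a] in both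
    configurations, some at [b], and equal points do not slide. *)
Lemma slide_homotopic (Y : topologicalType) (P : set Y) (f g : Y -> X) :
  open P ->
  (forall y i, P y -> {for y, continuous (fun z => coord (f z) i)}) ->
  (forall y i, P y -> {for y, continuous (fun z => coord (g z) i)}) ->
  (forall y i, P y -> -1 < dot (coord (f y) i) (coord (g y) i)) ->
  (forall y, P y -> exists i, coord (f y) i = a /\ coord (g y) i = a) ->
  (forall y, P y -> exists i, coord (f y) i = b /\ coord (g y) i = b) ->
  @homotopic_on R _ _ P f g.
Proof.
move=> oP cf cg fg fga fgb.
pose h (p : Y * R) : {ptws 'I_n -> S1} := fun i => slide (coord (f p.1) i)
  (coord (g p.1) i) p.2.
pose H p : X := insubd (f p.1) (h p).
have HE p : P p.1 -> \val (H p) = h p.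
  move=> Pp; rewrite val_insubd ifT //.
  have [i [fi gi]] := fga _ Pp; have [j [fj gj]] := fgb _ Pp.
  by apply: (@anchors_conf _ i j); rewrite /h ?fi ?gi ?fj ?gj slide_id.
exists H; split.
- move=> y t Py; apply/subtype_continuousP.
  apply: (@near_eq_continuous _ _ _ h).
    have : \forall p \near (y, t), P p.1 by apply: near_fst; exact: open_nbhs_nbhs.
    by apply: filterS => p /HE.
  apply/ptws_continuousP => i; apply: slide_continuous; first exact: fg.
  + by apply: (@continuous_comp _ _ _ fst (fun z => coord (f z) i));
    [exact: cvg_fst|exact: cf].
  + by apply: (@continuous_comp _ _ _ fst (fun z => coord (g z) i));
    [exact: cvg_fst|exact: cg].
  + exact: cvg_snd.
- move=> y t Py t0; apply: conf_eq => i; rewrite /coord HE // /h slide_le0 //.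
- move=> y t Py t1; apply: conf_eq => i; rewrite /coord HE // /h slide_ge1 //.
Qed.

(** * Path-connectedness of the anchored configuration space *)

Section Connected.
Variables (Y : topologicalType) (P : set Y).
Hypothesis oP : open P.
Notation conn x x' := (@homotopic_on R Y X P (fun=> x) (fun=> x')).

Lemma conn_same_anchors (x x' : X) i j :
  coord x i = a -> coord x' i = a -> coord x j = b -> coord x' j = b -> conn x x'.
Proof.
move=> xi x'i xj x'j.
(* Coordinates of [x] and [x'] may be antipodal; passing through [midway] avoids this and keeps the
   shared anchors. *)
pose m : {ptws 'I_n -> S1} := fun l => midway (coord x l) (coord x' l).
have mi : m i = a by rewrite /m xi x'i midwaypp.
have mj : m j = b by rewrite /m xj x'j midwaypp.
apply: (@homotopic_on_trans _ _ _ _ _ (fun=> conf_of mi mj)).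
  apply: slide_homotopic => //; try by move=> *; exact: cst_continuous.
  - by move=> y l _; exact: dot_midwayl.
  - by move=> y _; exists i; split.
  - by move=> y _; exists j; split.
apply: slide_homotopic => //; try by move=> *; exact: cst_continuous.
- by move=> y l _; exact: dot_midwayr.
- by move=> y _; exists i; split.
- by move=> y _; exists j; split.
Qed.

Hypothesis ab : a <> b.

Lemma anchors_neq (x : X) i j : coord x i = a -> coord x j = b -> i != j.
Proof. by move=> xi xj; apply/eqP => ij; apply: ab; rewrite -xi ij xj. Qed.

(** With [a] held at [i], all other points gather at [b]; that configuration has [b] both at [j] and
    at [j']. *)
Lemma conn_swap_b (x x' : X) i j j' : coord x i = a -> coord x j = b ->
  coord x' i = a -> coord x' j' = b -> conn x x'.
Proof.
move=> xi xj x'i x'j'.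
pose m : {ptws 'I_n -> S1} := fun l => if l == i then a else b.
have mi : m i = a by rewrite /m eqxx.
have mj l : l != i -> m l = b by rewrite /m => /negPf ->.
have mj1 : m j = b by apply: mj; rewrite eq_sym; exact: anchors_neq xi xj.
have mj2 : m j' = b by apply: mj; rewrite eq_sym; exact: anchors_neq x'i x'j'.
apply: (@homotopic_on_trans _ _ _ _ _ (fun=> conf_of mi mj1)).
  exact: (@conn_same_anchors _ _ i j).
exact: (@conn_same_anchors _ _ i j').
Qed.

Lemma conn_swap_a (x x' : X) i i' j : coord x i = a -> coord x j = b ->
  coord x' i' = a -> coord x' j = b -> conn x x'.
Proof.
move=> xi xj x'i x'j'.
pose m : {ptws 'I_n -> S1} := fun l => if l == j then b else a.
have mj : m j = b by rewrite /m eqxx.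
have mi l : l != j -> m l = a by rewrite /m => /negPf ->.
have mi1 : m i = a by apply: mi; exact: anchors_neq xi xj.
have mi2 : m i' = a by apply: mi; exact: anchors_neq x'i x'j'.
apply: (@homotopic_on_trans _ _ _ _ _ (fun=> conf_of mi1 mj)).
  exact: (@conn_same_anchors _ _ i j).
exact: (@conn_same_anchors _ _ i' j).
Qed.

Lemma two_anchors i j : i != j -> exists x : X, coord x i = a /\ coord x j = b.
Proof.
move=> ij; pose m : {ptws 'I_n -> S1} := fun l => if l == i then a else b.
have mi : m i = a by rewrite /m eqxx.
have mj : m j = b by rewrite /m eq_sym (negPf ij).
by exists (conf_of mi mj).
Qed.

Lemma conf_connected (x x' : X) : (2 < n)%N -> conn x x'.
Proof.
move=> n3; have [[i xi] [j xj]] := coord_anchors x.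
have [[i' x'i] [j' x'j]] := coord_anchors x'.
(* If [i'] differs from [j], it can take over [a] while [j] holds [b]. Otherwise a third index [l],
   which exists as [n >= 3], first takes over [b] from [j]. *)
have [ji'|ji'] := eqVneq j i'; last first.
  have i'j : i' != j by rewrite eq_sym.
  have [y [yi' yj]] := two_anchors i'j.
  apply: homotopic_on_trans (conn_swap_a xi xj yi' yj) _.
  exact: conn_swap_b yi' yj x'i x'j.
have [l /andP[li lj]] : exists l, (l != i) && (l != j).
  apply/existsP; apply: contraLR n3; rewrite negb_exists -leqNgt => /forallP h.
  have ij : (#|[set: 'I_n]%SET| <= #|[set i; j]%SET|)%N.
    apply: subset_leq_card; apply/fintype.subsetP => l _.
    by have := h l; rewrite negb_and !negbK !inE.
  by rewrite cardsT card_ord cards2 in ij; apply: leq_trans ij _; case: eqVneq.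
have il : i != l by rewrite eq_sym.
have [y [yi yl]] := two_anchors il.
have i'l : i' != l by rewrite -ji' eq_sym.
have [z [zi' zl]] := two_anchors i'l.
apply: homotopic_on_trans (conn_swap_b xi xj yi yl) _.
apply: homotopic_on_trans (conn_swap_a yi yl zi' zl) _.
exact: conn_swap_b zi' zl x'i x'j.
Qed.

End Connected.

(** * The open cover by avoided heights *)

Section UpperBound.
Variable s : nat.
Notation Xs := {ptws 'I_s -> X}.
Hypothesis ab : a <> b.

Definition avoiding (rho : R) : set Xs :=
  [set u | forall k i, `|chord a b (coord (u k) i)| != rho].

Lemma avoiding_open rho : open (avoiding rho).
Proof.
rewrite openE => u au.
have Nki k : \forall v \near u, forall i, `|chord a b (coord (v k) i)| != rho.
  have Ni i : \forall v \near u, `|chord a b (coord (v k) i)| != rho.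
    pose F (v : Xs) : R := `|chord a b (coord (v k) i)|.
    have cF : {for u, continuous F}.
      apply: (@continuous_comp _ _ _ (fun v : Xs => coord (v k) i)
        (fun p => `|chord a b p|)).
        apply: (@continuous_comp _ _ _ (fun v : Xs => v k) (fun x => coord x i)).
          exact: ptws_eval_continuous.
        exact: conf_coord_continuous.
      apply: (@continuous_comp _ _ _ (chord a b) Num.norm).
        exact: chord_continuous.
      exact: norm_continuous.
    have := au k i; rewrite -/(F u) neq_lt => /orP[lt|lt].
      have : \forall v \near u, F v < rho.
        by apply: (cF [set r | r < rho]); exact: lt_nbhsl.
      by apply: filterS => v vr; rewrite lt_eqF.
    have : \forall v \near u, rho < F v.
      by apply: (cF [set r | rho < r]); exact: lt_nbhsr.
    by apply: filterS => v vr; rewrite gt_eqF.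
  refine (@filter_forall _ _ (fun i v => `|chord a b (coord (v k) i)| != rho)
    (nbhs u) _ Ni).
refine (@filter_forall _ _ (fun k v => forall i, `|chord a b (coord (v k) i)| !=
  rho) (nbhs u) _ Nki).
Qed.

Lemma avoiding_local_section rho (x0 : X) : (1 < s)%N -> (2 < n)%N ->
  0 < rho -> rho <= chord_radius a b -> has_local_section R (avoiding rho).
Proof.
move=> s1 n3 r0 rr; have oA := avoiding_open rho.
apply: (@local_section_of_homotopies _ _ _ _ x0) => // k.
have tP (x : X) : (fun i => target a b rho (coord x i)) \in X.
  have [[i xi] [j xj]] := coord_anchors x.
  apply: (@anchors_conf _ i j); rewrite ?xi ?xj; first exact: targeta.
  exact: targetb.
pose g (u : Xs) : X := exist _ (fun i => target a b rho (coord (u k) i)) (tP (u k)).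
have cuk i (u : Xs) : {for u, continuous (fun v : Xs => coord (v k) i)}.
  apply: (@continuous_comp _ _ _ (fun v : Xs => v k) (fun x => coord x i)).
    exact: ptws_eval_continuous.
  exact: conf_coord_continuous.
have gP u : avoiding rho u -> \forall v \near u, avoiding rho v /\ g v = g u.
  move=> au.
  have gi i : \forall v \near u, coord (g v) i = coord (g u) i.
    have nt := @target_locally_constant _ a b ab rho r0 rr _ (au k i).
    have nt' : \forall v \near u, `|chord a b (coord (v k) i)| != rho /\
      target a b rho (coord (v k) i) = target a b rho (coord (u k) i) :=
        cuk i u _ nt.
    by apply: (@filterS _ _ (nbhs_filter u) _ _ _ nt') => v [].
  have gi' : \forall v \near u, forall i, coord (g v) i = coord (g u) i.
    refine (@filter_forall _ _ (fun i v => coord (g v) i = coord (g u) i)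
      (nbhs u) _ gi).
  have au' : \forall v \near u, avoiding rho v by exact: open_nbhs_nbhs.
  apply: (@filterS _ _ (nbhs_filter u) _ _ _
    (@filterI _ _ (nbhs_filter u) _ _ au' gi')) => v [av gv].
  by split=> //; exact: conf_eq.
apply: (@homotopic_on_glue _ _ _ _ _ g) => //; last first.
  by move=> x; exact: conf_connected.
apply: slide_homotopic => //.
- move=> u i /gP guN; apply: (@near_eq_continuous _ _ _ (fun=> coord (g u) i)).
    by apply: filterS guN => v [_ ->].
  exact: cst_continuous.
- by move=> u i _; exact: dot_target.
- move=> u _; have [[i xi] _] := coord_anchors (u k); exists i; split=> //.
  by rewrite /coord /= -/(coord (u k) i) xi targeta.
- move=> u _; have [_ [i xi]] := coord_anchors (u k); exists i; split=> //.
  by rewrite /coord /= -/(coord (u k) i) xi targetb.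
Qed.

Lemma card_moving (u : Xs) :
  (#|[set c : 'I_s * 'I_n | chord a b (coord (u c.1) c.2) != 0%R]%SET| <= s * (n
    - 2))%N.
Proof.
rewrite -sum1_card; under eq_bigl => c do rewrite inE.
rewrite -(pair_big_dep xpredT (fun k i => chord a b (coord (u k) i) != 0%R)
  (fun _ _ => 1%N)) /=.
rewrite -[X in (_ <= X * _)%N]card_ord -sum_nat_const; apply: leq_sum => k _.
have [[i ui] [j uj]] := coord_anchors (u k).
have ij := anchors_neq ab ui uj.
rewrite sum1_card -[X in (_ <= X - _)%N](card_ord n) -[X in (_ <= _ - X)%N](_ :
  #|[set i; j]%SET| = 2).
  rewrite -cardsT -cardsDS ?subsetT //; apply: subset_leq_card.
  apply/fintype.subsetP => l; rewrite !inE unfold_in => ul; rewrite andbT.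
  by apply: contra ul => /orP[]/eqP->; rewrite ?ui ?uj ?chorda ?chordb.
by rewrite cards2 ij.
Qed.

Lemma conf_motion_cover : (1 < s)%N -> (2 < n)%N ->
  motion_cover R s X (s * (n - 2)).+1.
Proof.
move=> s1 n3; set m := (s * (n - 2))%N.
have [x0 _] : exists x0 : X, coord x0 (Ordinal (ltnW (ltnW n3))) = a /\ coord x0
  (Ordinal (ltnW n3)) = b.
  exact: two_anchors.
pose rho (k : nat) : R := chord_radius a b / k.+1%:R.
have cr0 := chord_radius_gt0 ab.
have rho0 k : 0 < rho k by rewrite divr_gt0.
have rho_le k : rho k <= chord_radius a b.
  by rewrite ler_pdivrMr // ler_peMr ?(ltW cr0) // ler1n.
have rho_inj k l : rho k = rho l -> k = l.
  move=> /(mulfI (lt0r_neq0 cr0)) /invr_inj /eqP.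
  by rewrite eqr_nat => /eqP[].
exists (fun k => avoiding (rho k)); split=> [k||k]; first exact: avoiding_open.
  apply/seteqP; split=> // u _; apply: contrapT => nu.
  (* A tuple outside all the sets meets each height at some coordinate. Distinct heights give
     distinct coordinates off the chord, one more than [card_moving] allows. *)
  have /choice[c cP] : forall k : 'I_m.+1, exists c : 'I_s * 'I_n,
      `|chord a b (coord (u c.1) c.2)| = rho k.
    move=> k; apply: contrapT => nk; apply: nu; exists k => // j i.
    by apply/eqP => E; apply: nk; exists (j, i).
  have c_inj : injective c by move=> k l ckl; apply/val_inj/rho_inj;
    rewrite -!cP ckl.
  have := card_moving u; rewrite leqNgt; apply/negP/negPn.
  rewrite -[X in (X <= _)%N]card_ord -(card_codom c_inj); apply: subset_leq_card.
  apply/fintype.subsetP => _ /codomP[k ->]; rewrite inE -normr_eq0 cP.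
  by rewrite gt_eqF.
exact: avoiding_local_section.
Qed.

End UpperBound.
End AnchoredConf.

(** * Winding numbers modulo 2 *)

Section Crossing.
Context {R : realType}.
Notation S1 := (circle R).
Implicit Types p q r : S1.

(* Counts modulo 2 how often a short step crosses the ray from the origin
   through (-1, 0). *)
Definition crossing p q : 'F_2 :=
  [&& px p < 0, px q < 0 & (0 <= py p) != (0 <= py q)]%:R.

Definition close p q := `|px p - px q| < 1 /\ `|py p - py q| < 1.

Lemma crossingpp p : crossing p p = 0.
Proof. by rewrite /crossing eqxx !andbF. Qed.

Lemma crossingC p q : crossing p q = crossing q p.
Proof. by rewrite /crossing andbCA eq_sym. Qed.

Lemma norm1_ge1 p : 1 <= `|px p| + `|py p|.
Proof.
have := circleE p; rewrite -[px p ^+ 2]real_normK ?num_real // -[py p ^+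
  2]real_normK ?num_real //.
have := normr_ge0 (px p); have := normr_ge0 (py p).
move: `|px p| `|py p| => x y y0 x0 h; nra.
Qed.

(** If both signs changed, the two differences would be sums of absolute values, adding up to at
    least 2 by [norm1_ge1] for [p] and [q]. *)
Lemma close_quadrant p q : close p q ->
  ((px p < 0) == (px q < 0)) || ((0 <= py p) == (0 <= py q)).
Proof.
wlog xp : p q / px p < 0 => [hw|].
  have [xp|xp] := ltP (px p) 0; first by move=> pq; have := hw p q xp pq;
    rewrite xp.
  have [xq|xq] := ltP (px q) 0; last by rewrite orTb.
  move=> [c1 c2]; have := hw q p xq; rewrite /close distrC [`|py q - _|]distrC xq.
  by rewrite (le_gtF xp) eq_sym [(0 <= py q) == _]eq_sym; apply.
rewrite xp; case: ltP => // xq; rewrite orFb => -[c1 c2].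
have nx : `|px p - px q| = `|px p| + `|px q|.
  by rewrite (ltr0_norm xp) (ger0_norm xq) ltr0_norm; lra.
have := norm1_ge1 p; have := norm1_ge1 q; rewrite nx in c1 => h1 h2.
case: leP => yp; case: leP => yq //.
  have ny : `|py p - py q| = `|py p| + `|py q|.
    by rewrite (ger0_norm yp) (ltr0_norm yq) ger0_norm; lra.
  by exfalso; lra.
have ny : `|py p - py q| = `|py p| + `|py q|.
  by rewrite (ltr0_norm yp) (ger0_norm yq) ltr0_norm; lra.
by exfalso; lra.
Qed.

(** Closeness excludes opposite quadrants; the identity is then checked on all sign patterns. *)
Lemma crossing_cocycle p q r : close p q -> close q r -> close p r ->
  crossing p q + crossing q r = crossing p r.
Proof.
move=> /close_quadrant + /close_quadrant + /close_quadrant; rewrite /crossing.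
case: (px p < 0); case: (px q < 0); case: (px r < 0);
case: (0 <= py p); case: (0 <= py q); case: (0 <= py r) => // *; exact/eqP.
Qed.

(** Homotopy invariance of crossing numbers: the ladder between two discrete paths is cut into
    triangles along the diagonals from [p i] to [q i.+1], and only the end rungs survive. *)
Lemma sum_crossing (p q : nat -> S1) j :
  (forall i, (i <= j)%N -> close (p i) (q i)) ->
  (forall i, (i < j)%N -> [/\ close (p i) (p i.+1), close (q i)
    (q i.+1) & close (p i) (q i.+1)]) ->
  \sum_(i < j) crossing (p i) (p i.+1) + \sum_(i < j) crossing (q i) (q i.+1) =
  crossing (p 0%N) (q 0%N) + crossing (p j) (q j).
Proof.
elim: j => [|j IH] pq pj; first by rewrite !big_ord0 F2_addrr addr0.
rewrite !big_ord_recr /= addrACA IH; last 2 first.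
- by move=> i ij; apply: pq; exact: leqW.
- by move=> i ij; apply: pj; exact: leqW.
have [c1 c2 c3] := pj j (leqnn _).
rewrite -addrA; congr (_ + _).
have E1 := crossing_cocycle (pq j (leqW (leqnn _))) c2 c3.
have E2 := crossing_cocycle c1 (pq j.+1 (leqnn _)) c3.
by rewrite addrCA E1 -E2 addrA F2_addrr add0r.
Qed.

Lemma loop_subproof (x : R) : (cos (2 * pi * x), sin (2 * pi * x)) \in circle R.
Proof. by rewrite inE /circle /= cos2Dsin2. Qed.

Definition loop (x : R) : S1 := exist _ (cos (2 * pi * x), sin (2 * pi * x))
  (loop_subproof x).

Lemma loop_continuous : continuous loop.
Proof.
have cm (x : R) : {for x, continuous (fun y : R => 2 * pi * y : R)}.
  by apply: continuousM; [exact: cst_continuous|exact: cvg_id].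
move=> x; apply: circle_continuousP.
  by apply: (@continuous_comp _ _ _ (fun y => 2 * pi * y) cos) => //;
    exact: continuous_cos.
by apply: (@continuous_comp _ _ _ (fun y => 2 * pi * y) sin) => //;
  exact: continuous_sin.
Qed.

Lemma loopDn x (k : nat) : loop (x + k%:R) = loop x.
Proof.
elim: k => [|k IH]; first by rewrite addr0.
rewrite -natr1 addrA -IH; set y := x + _.
apply: circle_eq; rewrite /px /py /= mulrDr mulr1 mulr_natl.
  exact: cosD2pi.
exact: sinD2pi.
Qed.

(** * Winding on the circle divided into [4 * M] steps *)

Section Winding.
Variable M : nat.
Hypothesis M2 : (2 <= M)%N.
Let L := (4 * M)%N.

Definition grid_loop (i : nat) : S1 := loop (i%:R / L%:R).

(** A primitive, modulo 2, of the degree one class of the circle: it grows by one with each turn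
    ([windingDL], [windingL]). *)
Definition winding (x : nat) : 'F_2 :=
  \sum_(i < x) crossing (grid_loop i) (grid_loop i.+1).

Lemma L_neq0 : L%:R != 0 :> R.
Proof. by rewrite pnatr_eq0 /L; have := M2; lia. Qed.

Lemma grid_loopDL i k : grid_loop (i + k * L) = grid_loop i.
Proof. by rewrite /grid_loop natrD natrM mulrDl mulfK ?L_neq0 // loopDn. Qed.

Lemma windingDL x : winding (x + L) = winding x + winding L.
Proof.
rewrite /winding [in LHS]addnC big_split_ord /= addrC; congr (_ + _).
apply: eq_bigr => i _.
by rewrite addnC -addSn -[L]mul1n !grid_loopDL.
Qed.

Lemma grid_angle i : 2 * pi * (i%:R / L%:R) = pi * (i%:R / (2 * M)%:R) :> R.
Proof.
have M0 : M%:R != 0 :> R by rewrite pnatr_eq0 -lt0n (leq_trans _ M2).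
rewrite /L !natrM; field; exact: M0.
Qed.

Lemma sin_grid_ge0 i : (i <= 2 * M)%N -> 0 <= py (grid_loop i).
Proof.
move=> iM; rewrite /py /= grid_angle; apply: sin_ge0_pi.
have d0 : 0 < (2 * M)%:R :> R by rewrite ltr0n muln_gt0 /= (leq_trans _ M2).
rewrite mulr_ge0 ?pi_ge0 ?divr_ge0 //= -[leRHS]mulr1 ler_pM2l ?pi_gt0 //.
by rewrite ler_pdivrMr // mul1r ler_nat.
Qed.

Lemma sin_grid_lt0 i : (2 * M < i < L)%N -> py (grid_loop i) < 0.
Proof.
move=> /andP[i1 i2]; rewrite /py /= grid_angle.
have d0 : 0 < (2 * M)%:R :> R by rewrite ltr0n muln_gt0 /= (leq_trans _ M2).
have -> : pi * (i%:R / (2 * M)%:R) = pi * ((i - 2 * M)%:R / (2 * M)%:R) + pi :> R.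
  by rewrite natrB ?(ltnW i1) // mulrBl divff ?gt_eqF // mulrBr mulr1 subrK.
rewrite sinDpi oppr_lt0; apply: sin_gt0_pi.
rewrite mulr_gt0 ?pi_gt0 ?divr_gt0 // ?ltr0n ?subn_gt0 //=.
rewrite -[ltRHS]mulr1 ltr_pM2l ?pi_gt0 // ltr_pdivrMr // mul1r ltr_nat.
by rewrite /L in i2; lia.
Qed.

Lemma cos_grid_lt0 i : (M < i < 3 * M)%N -> px (grid_loop i) < 0.
Proof.
move=> /andP[i1 i2]; rewrite /px /= grid_angle.
have d0 : 0 < (2 * M)%:R :> R by rewrite ltr0n muln_gt0 /= (leq_trans _ M2).
have -> : pi * (i%:R / (2 * M)%:R) = pi * (i%:R / (2 * M)%:R - 1) + pi :> R.
  by rewrite mulrBr mulr1 subrK.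
rewrite cosDpi oppr_lt0; apply: cos_gt0_pihalf.
rewrite -mulrN ltr_pM2l ?pi_gt0 // ltr_pM2l ?pi_gt0 //.
have {}i1 : M%:R < i%:R :> R by rewrite ltr_nat.
have {}i2 : i%:R < 3 * M%:R :> R by rewrite -natrM ltr_nat.
rewrite ltrBlDr ltrBrDr ltr_pdivlMr // ltr_pdivrMr // natrM.
by apply/andP; split; lra.
Qed.

(** The only crossing in a turn is the step leaving the grid point [2 * M], which is [(-1, 0)] and
    counts as upper half. [M >= 2] keeps the next point in the left half plane. *)
Lemma windingL : winding L = 1.
Proof.
have M2L : (2 * M < L)%N by rewrite /L; lia.
rewrite /winding (bigD1 (Ordinal M2L)) //= [X in _ + X]big1 ?addr0.
  have m2 := M2.
  rewrite /crossing (sin_grid_ge0 (leqnn _)) leNgt sin_grid_lt0;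
    last by rewrite /L; lia.
  by rewrite !cos_grid_lt0 //; lia.
move=> [i iL]; rewrite -val_eqE /= => iM.
have [lt|ge] := leqP i (2 * M).
  have lt' : (i < 2 * M)%N by rewrite ltn_neqAle iM.
  by rewrite /crossing !sin_grid_ge0 ?andbF // (ltnW lt').
have [iL'|iL'] := ltnP i.+1 L.
  rewrite /crossing ![0 <= _]leNgt !sin_grid_lt0 ?andbF //; apply/andP; split; lia.
(* The last step of the turn ends at [(1, 0)], outside the left half plane. *)
have -> : i.+1 = (0 + 1 * L)%N by lia.
rewrite grid_loopDL /crossing /px /= mul0r mulr0 cos0.
by rewrite (le_gtF ler01) andbF.
Qed.

Lemma winding_cube v x y : (v <= x <= v + 1)%N -> (v <= y <= v + 1)%N ->
  winding x + winding y = crossing (grid_loop x) (grid_loop y).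
Proof.
wlog xy : x y / (x <= y)%N => [hw vx vy|/andP[vx xv] /andP[vy yv]].
  have [/hw|/ltnW/hw] := leqP x y; first exact.
  by rewrite addrC crossingC; exact.
have [->|->] : y = x \/ y = x.+1 by lia.
  by rewrite F2_addrr crossingpp.
by rewrite /winding big_ord_recr /= addrA F2_addrr add0r.
Qed.

End Winding.
End Crossing.

(** * The lower bound *)

(** Stated for a monotone relation between radii and sets instead of a cover, so that the same
    number can also bound time steps. *)
Lemma lebesgue_number (R : realType) (T : pseudoMetricType R) (A : set T)
    (Q : R -> set T -> Prop) : compact A ->
  (forall d d' B B', d' <= d -> B' `<=` B -> Q d B -> Q d' B') ->
  (forall x, A x -> exists2 d, 0 < d & Q d (ball x d)) ->
  exists2 e, 0 < e & forall x, A x -> Q e (ball x e).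
Proof.
move=> /compact_near_coveringP cA Qmono AQ.
have : \forall e \near (0 : R)^'+, A `<=` (fun x => Q e (ball x e)).
  apply: (cA _ _ (fun e x => Q e (ball x e))) => x Ax.
  have [d d0 Qd] := AQ x Ax; have d20 : 0 < d / 2 by rewrite divr_gt0.
  exists (ball x (d / 2), [set e | 0 < e < d / 2]) => /=.
    split; first exact: nbhsx_ballx.
    by near=> e => /=; apply/andP; split; near: e;
      [exact: nbhs_right_gt|exact: nbhs_right_lt].
  move=> [y e] /= [xy /andP[e0 ed]]; apply: Qmono Qd; first by lra.
  move=> z yz; apply: (le_ball (e1 := d / 2 + e)); first by lra.
  exact: ball_triangle xy yz.
move=> Ae; have : \forall e \near (0 : R)^'+, 0 < e /\ A `<=`
  (fun x => Q e (ball x e)).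
  by apply: filterI => //; exact: nbhs_right_gt.
by move=> /filter_ex[e [e0 eA]]; exists e.
Unshelve. all: by end_near. Qed.

Section LowerBound.
Context {R : realType} {n s : nat}.
Notation S1 := (circle R).
Variables a b : S1.
Notation X := (anchored_conf R n [set a; b]).
Notation Xs := {ptws 'I_s -> X}.
Hypotheses (n3 : (2 < n)%N) (ns : (uphalf n <= s)%N).

(** The held pair is [2k], [2k + 1], cut off at the last two indices; as [n <= 2s], these pairs
    exhaust all indices ([anchors_cover]). *)
Lemma first_anchor_subproof (k : 'I_s) : (minn k.*2 (n - 2) < n)%N.
Proof. by have := n3; lia. Qed.

Lemma second_anchor_subproof (k : 'I_s) : ((minn k.*2 (n - 2)).+1 < n)%N.
Proof. by have := n3; lia. Qed.

Definition first_anchor k : 'I_n := Ordinal (first_anchor_subproof k).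
Definition second_anchor k : 'I_n := Ordinal (second_anchor_subproof k).

Lemma second_neq_first k : second_anchor k != first_anchor k.
Proof. by rewrite -val_eqE /=; lia. Qed.

Lemma anchors_cover (i : 'I_n) : exists k, (i == first_anchor k) || (i ==
  second_anchor k).
Proof.
have ks : (i./2 < s)%N by have := ns; have := ltn_ord i; lia.
exists (Ordinal ks); rewrite -!val_eqE /=; have := ltn_ord i; have := n3.
lia.
Qed.

Let K := ('I_s * 'I_n)%type.

Definition torus_conf (th : K -> R) (k : 'I_s) : {ptws 'I_n -> S1} := fun i =>
  if i == first_anchor k then a else if i == second_anchor k then b
  else loop (th (k, i)).

Lemma torus_first th k : torus_conf th k (first_anchor k) = a.
Proof. by rewrite /torus_conf eqxx. Qed.

Lemma torus_second th k : torus_conf th k (second_anchor k) = b.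
Proof. by rewrite /torus_conf (negPf (second_neq_first k)) eqxx. Qed.

Definition torus (th : K -> R) : Xs := fun k => conf_of (torus_first th k)
  (torus_second th k).

Lemma coord_torus th k i : coord (torus th k) i = torus_conf th k i.
Proof. by []. Qed.

Lemma torus_eq th th' : (forall c, loop (th c) = loop (th' c)) ->
  torus th = torus th'.
Proof.
move=> E; apply/funext => k; apply: conf_eq => i.
by rewrite !coord_torus /torus_conf E.
Qed.

(** Row vectors carry the metric and the compact boxes used for the Lebesgue number. *)
Notation V := 'rV[R]_#|{: K}|.

Definition row_angles (th : V) : K -> R := fun c => th ord0 (enum_rank c).

Lemma torus_continuous : continuous (fun th : V => torus (row_angles th)).
Proof.
move=> th; apply/ptws_continuousP => k; apply/subtype_continuousP.
apply/ptws_continuousP => i; rewrite /= /torus_conf.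
case: (i == first_anchor k); first exact: cst_continuous.
case: (i == second_anchor k); first exact: cst_continuous.
apply: (@continuous_comp _ _ _ (fun th : V => row_angles th (k, i)) loop).
  exact: coord_continuous.
exact: loop_continuous.
Qed.

(** * Closeness of neighbouring paths *)

Section Paths.
Variables (U : set Xs) (G : Xs * R -> X).
Hypothesis oU : open U.
Hypothesis cG : forall u t, U u -> {for (u, t), continuous G}.

Lemma close_near (th : V) (t : R) : U (torus (row_angles th)) ->
  exists2 d, 0 < d & forall (th1 th2 : V)
    (t1 t2 : R), ball th d th1 -> ball th d th2 ->
    ball t d t1 -> ball t d t2 -> U (torus (row_angles th1)) /\
    forall i, close (coord (G (torus (row_angles th1), t1)) i)
                    (coord (G (torus (row_angles th2), t2)) i).
Proof.
move=> Uth.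
pose F (p : V * R) : X := G (torus (row_angles p.1), p.2).
have cF : {for (th, t), continuous F}.
  apply: (@continuous_comp _ _ _ (fun p : V * R =>
    (torus (row_angles p.1), p.2)) G).
    apply: pair_continuous; last exact: cvg_snd.
    apply: (@continuous_comp _ _ _ (fun p : V * R => p.1)
      (fun th : V => torus (row_angles th))).
      exact: cvg_fst.
    exact: torus_continuous.
  exact: cG.
(* Two values within [1/2] of the central one differ by less than 1, the bound in [close]. *)
have nearF (f : S1 -> R) : continuous f ->
    \forall p \near (th, t), forall i, `|f (coord (F p) i) - f (coord (F (th, t))
      i)| < 2^-1.
  move=> cf; have ni i : \forall p \near (th, t), `|f (coord (F p) i) - f (coord
    (F (th, t)) i)| < 2^-1.
    have c : {for (th, t), continuous (fun p => f (coord (F p) i))}.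
      apply: (@continuous_comp _ _ _ (fun p => coord (F p) i) f); last exact: cf.
      apply: (@continuous_comp _ _ _ F (fun x => coord x i)); first exact: cF.
      exact: conf_coord_continuous.
    have h2 : 0 < 2^-1 :> R by rewrite invr_gt0.
    have := c (ball (f (coord (F (th, t)) i)) 2^-1) (nbhsx_ballx _ _ h2).
    apply: (@filterS _ _ (nbhs_filter (th, t))) => p /=.
    by rewrite /ball /= distrC.
  exact: (@filter_forall _ _ (fun i p => `|f (coord (F p) i) - f (coord (F (th,
    t)) i)| < 2^-1) _ (nbhs_filter (th, t)) ni).
have nU : \forall p \near (th, t), U (torus (row_angles p.1)).
  apply: (@near_fst _ _ _ _ [set th | U (torus (row_angles th))]).
  have nt : nbhs (torus (row_angles th)) U by exact: open_nbhs_nbhs.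
  have ct : {for th, continuous (fun th : V => torus (row_angles th))} :=
    @torus_continuous th.
  exact: ct U nt.
have := @filterI _ _ (nbhs_filter (th, t)) _ _ nU
  (@filterI _ _ (nbhs_filter (th, t)) _ _ (nearF _ px_continuous)
    (nearF _ py_continuous)).
move=> [[A B] /= [/nbhs_ballP[d1 /= d10 dA] /nbhs_ballP[d2 /= d20 dB]] AB].
exists (Num.min d1 d2); first by rewrite lt_min d10 d20.
have lA : ball th (Num.min d1 d2) `<=` A.
  by move=> x /le_ball h; apply/dA/h; rewrite ge_min lexx.
have lB : ball t (Num.min d1 d2) `<=` B.
  by move=> x /le_ball h; apply/dB/h; rewrite ge_min lexx orbT.
move=> th1 th2 t1 t2 /lA A1 /lA A2 /lB B1 /lB B2.
have [/= U1 [x1 y1]] := AB (th1, t1) (conj A1 B1).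
have [/= _ [x2 y2]] := AB (th2, t2) (conj A2 B2).
split=> // i; split.
- rewrite -(subrKA (px (coord (F (th, t)) i))) (le_lt_trans (ler_normD _ _)) //.
  by rewrite [X in _ < X]splitr div1r ltrD ?x1 // distrC x2.
- rewrite -(subrKA (py (coord (F (th, t)) i))) (le_lt_trans (ler_normD _ _)) //.
  by rewrite [X in _ < X]splitr div1r ltrD ?y1 // distrC y2.
Qed.

(** Compactness of the time interval makes the radius independent of [t]. *)
Lemma close_uniform (th : V) : U (torus (row_angles th)) ->
  exists2 d, 0 < d & forall th1 th2 : V, ball th d th1 -> ball th d th2 ->
    U (torus (row_angles th1)) /\
    forall t t1 t2 : R, 0 <= t <= 1 -> ball t d t1 -> ball t d t2 ->
    forall i, close (coord (G (torus (row_angles th1), t1)) i)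
                    (coord (G (torus (row_angles th2), t2)) i).
Proof.
move=> Uth.
have [||e e0 eP] := @lebesgue_number R R `[0, 1] (fun d B =>
    forall (th1 th2 : V) (t1 t2 : R), ball th d th1 -> ball th d th2 -> B t1 ->
      B t2 ->
    U (torus (row_angles th1)) /\
    forall i, close (coord (G (torus (row_angles th1), t1)) i)
                    (coord (G (torus (row_angles th2), t2)) i))
                      (@segment_compact _ 0 1).
- move=> d d' B B' dd BB QB th1 th2 t1 t2 h1 h2 /BB b1 /BB b2.
  by apply: QB => //; [exact: le_ball dd _ h1|exact: le_ball dd _ h2].
- by move=> t _; exact: close_near.
exists e => // th1 th2 h1 h2; split.
  have z01 : `[0, 1]%classic (0 : R) by rewrite /= in_itv /= lexx ler01.
  by have [] := eP 0 z01 th1 th2 0 0 h1 h2 (ballxx _ e0) (ballxx _ e0).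
move=> t t1 t2 t01 b1 b2.
have z01 : `[0, 1]%classic t by rewrite /= in_itv.
by have [] := eP t z01 th1 th2 t1 t2 h1 h2 b1 b2.
Qed.

End Paths.

(** Compactness of the cube of angles. One [e] controls angles and times, and one index [l] serves a
    whole ball, hence later a whole grid cube. *)
Lemma torus_cover_uniform N (U : 'I_N -> set Xs) (G : 'I_N -> Xs * R -> X) :
  (forall l, open (U l)) -> \bigcup_l U l = setT ->
  (forall l u t, U l u -> {for (u, t), continuous (G l)}) ->
  exists2 e, 0 < e & forall th : V, (forall j, 0 <= th ord0 j <= 1) ->
    exists l, forall th1 th2 : V, ball th e th1 -> ball th e th2 ->
    U l (torus (row_angles th1)) /\
    forall t t1 t2 : R, 0 <= t <= 1 -> ball t e t1 -> ball t e t2 ->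
    forall i, close (coord (G l (torus (row_angles th1), t1)) i)
                    (coord (G l (torus (row_angles th2), t2)) i).
Proof.
move=> oU cU cG.
have cK : compact [set th : V | forall j, `[0, 1]%classic (th ord0 j)].
  exact: (@rV_compact R _ (fun=> `[0, 1]%classic) (fun=> @segment_compact _ 0 1)).
have [||e e0 eP] := @lebesgue_number R V _
  (fun e B => exists l, forall th1 th2 : V, B th1 -> B th2 ->
    U l (torus (row_angles th1)) /\
    forall t t1 t2 : R, 0 <= t <= 1 -> ball t e t1 -> ball t e t2 ->
    forall i, close (coord (G l (torus (row_angles th1), t1)) i)
                    (coord (G l (torus (row_angles th2), t2)) i)) cK.
- move=> d d' B B' dd BB [l lP]; exists l => th1 th2 /BB b1 /BB b2.
  have [Ul cl] := lP _ _ b1 b2; split=> // t t1 t2 t01 h1 h2.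
  exact: (cl t t1 t2 t01 (le_ball dd h1) (le_ball dd h2)).
- move=> th _; have : (\bigcup_l U l) (torus (row_angles th)) by rewrite cU.
  move=> [l _ Ul]; have [d d0 dP] := close_uniform (oU l) (cG l) Ul.
  by exists d => //; exists l.
exists e => // th th01; apply: eP => j; rewrite /= in_itv /=; exact: th01.
Qed.

Definition free_coords : {set K} :=
  [set c : K | (c.2 != first_anchor c.1) && (c.2 != second_anchor c.1)]%SET.

Lemma card_free_coords : #|free_coords| = (s * (n - 2))%N.
Proof.
rewrite -sum1_card; under eq_bigl => c do rewrite inE.
rewrite -(pair_big_dep xpredT (fun k i => (i != first_anchor k) &&
  (i != second_anchor k)) (fun _ _ => 1%N)) /=.
rewrite -[X in (_ = X * _)%N]card_ord -sum_nat_const; apply: eq_bigr => k _.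
rewrite sum1_card -[X in _ = (X - _)%N](card_ord n) -[X in _ = (_ - X)%N](_ :
  #|[set first_anchor k; second_anchor k]%SET| = 2).
  rewrite -cardsT -cardsDS ?subsetT //; apply: eq_card => i.
  by rewrite !inE unfold_in andbT negb_or.
by rewrite cards2 eq_sym second_neq_first.
Qed.

(** * Sampling the torus and the time interval *)

Section Grid.
Variables (M : nat) (e : R).
Hypotheses (M2 : (2 <= M)%N) (Me : M%:R^-1 < e).
Let L := (4 * M)%N.

Definition grid_conf (w : K -> nat) : Xs := torus (fun c => (w c)%:R / L%:R).

Lemma grid_conf_periodic j w : grid_conf (shift j L w) = grid_conf w.
Proof. by apply: torus_eq => c; exact: grid_loopDL. Qed.

Lemma grid_conf_free w (c : K) : c \in free_coords ->
  coord (grid_conf w c.1) c.2 = grid_loop M (w c).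
Proof.
rewrite inE => /andP[c1 c2].
by rewrite coord_torus /torus_conf (negPf c1) (negPf c2) -surjective_pairing.
Qed.

Lemma grid_conf_fixed w w' k i : (i == first_anchor k) || (i == second_anchor k) ->
  coord (grid_conf w k) i = coord (grid_conf w' k) i.
Proof. by move=> h; rewrite !coord_torus /torus_conf;
  case: (i == first_anchor k) h => //= ->. Qed.

Lemma M_gt0 : 0 < M%:R :> R.
Proof. by rewrite ltr0n (leq_trans _ M2). Qed.

Lemma L_gt0 : 0 < L%:R :> R.
Proof. by rewrite ltr0n /L muln_gt0 /= (leq_trans _ M2). Qed.

Lemma grid_cube_ball v : exists2 th0 : V, (forall j, 0 <= th0 ord0 j <= 1) &
  forall w, in_cube [set: K]%SET v w ->
    exists2 th : V, ball th0 e th & grid_conf w = torus (row_angles th).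
Proof.
have L0 := L_gt0.
exists (\row_j ((v (enum_val j) %% L)%:R / L%:R)) => [j|w vw].
  rewrite mxE divr_ge0 //= ler_pdivrMr // mul1r ler_nat ltnW // ltn_mod.
  by rewrite -(ltr0n R).
(* Only the corner [v] is reduced modulo [L]; the offset [w - v] is added afterwards, so the cube
   stays in one small ball even across a multiple of [L]. *)
exists (\row_j ((v (enum_val j) %% L + (w (enum_val j) - v (enum_val j)))%:R /
  L%:R)); last first.
  apply: torus_eq => c; rewrite /row_angles mxE enum_rankK.
  rewrite -[RHS](grid_loopDL M2 _ (v c %/ L)) /grid_loop -/L;
    congr (loop (_%:R / _)).
  by have /andP[vc _] := vw c; rewrite addnAC [X in (X + _)%N]addnC -divn_eq subnKC.
split=> [|i j]; first by apply: lt_trans Me; rewrite invr_gt0 M_gt0.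
rewrite !mxE; have /andP[v1 v2] := vw (enum_val j).
rewrite /ball /= natrD mulrDl opprD addrA subrr sub0r normrN ger0_norm ?divr_ge0 //.
apply: le_lt_trans Me; rewrite ler_pdivrMr // /L natrM mulrCA mulVf ?gt_eqF
  ?M_gt0 // mulr1.
by rewrite ler_nat leq_subLR (leq_trans v2) // leq_add2l; case: (_ \in _).
Qed.

(** The step is chosen so that the [k]-th sample time is reached after exactly [k * M] steps. *)
Definition time (q : nat) : R := q%:R / (s.-1 * M)%:R.

Hypothesis s1 : (1 < s)%N.

Lemma sM_gt0 : 0 < (s.-1 * M)%:R :> R.
Proof. by rewrite ltr0n muln_gt0 (leq_trans _ M2) // andbT; have := s1; lia. Qed.

Lemma time_sample (k : nat) : time (k * M) = k%:R / s.-1%:R.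
Proof. by rewrite /time !natrM -mulf_div divff ?mulr1 // gt_eqF // M_gt0. Qed.

Lemma time_itv (k : 'I_s) q : (q <= k * M)%N -> 0 <= time q <= 1.
Proof.
move=> qk; rewrite divr_ge0 //= ler_pdivrMr ?sM_gt0 // mul1r ler_nat.
rewrite (leq_trans qk) // leq_mul2r; have := ltn_ord k; have := s1; lia.
Qed.

Lemma time_step q : ball (time q) e (time q.+1).
Proof.
rewrite /ball /= /time -natr1 mulrDl opprD addrA subrr sub0r normrN ger0_norm;
  last first.
  by rewrite mul1r invr_ge0 ltW // sM_gt0.
apply: le_lt_trans Me; rewrite mul1r lef_pV2 ?posrE ?sM_gt0 ?M_gt0 // ler_nat.
by rewrite leq_pmull //; have := s1; lia.
Qed.

Definition path_crossing (G : Xs * R -> X) u i (j : nat) : 'F_2 :=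
  \sum_(q < j) crossing (coord (G (u, time q)) i) (coord (G (u, time q.+1)) i).

Lemma path_crossingD (U : set Xs) (G : Xs * R -> X) u u' (k : 'I_s) i :
  (forall u (k : 'I_s), U u -> G (u, k%:R / s.-1%:R) = u k) ->
  U u -> U u' ->
  (forall v v' (t t1 t2 : R), (v = u \/ v = u') -> (v' = u \/ v' = u') ->
    0 <= t <= 1 -> ball t e t1 -> ball t e t2 ->
    close (coord (G (v, t1)) i) (coord (G (v', t2)) i)) ->
  path_crossing G u i (k * M) + path_crossing G u' i (k * M) =
  crossing (coord (G (u, 0)) i) (coord (G (u', 0)) i) +
  crossing (coord (u k) i) (coord (u' k) i).
Proof.
move=> eG Uu Uu' cl.
have e0 : 0 < e by apply: lt_trans Me; rewrite invr_gt0 M_gt0.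
have := @sum_crossing R (fun q => coord (G (u, time q)) i)
  (fun q => coord (G (u', time q)) i) (k * M).
rewrite time_sample !eG // /time mul0r; apply.
- move=> q /time_itv q01.
  by apply: (cl _ _ (time q)) => //; try exact: ballxx; [left|right].
- move=> q /ltnW/time_itv q01.
  by split; apply: (cl _ _ (time q)) => //;
    try exact: ballxx; try exact: time_step; by [left|right].
Qed.

End Grid.

Lemma motion_cover_card N : motion_cover R s X N -> ((s * (n - 2)).+1 <= N)%N.
Proof.
move=> [U [oU cU hU]]; rewrite ltnNge; apply/negP => Nm.
have s1 : (1 < s)%N by have := n3; have := ns; lia.
pose x0 : X := torus (fun=> 0) (Ordinal s1).
have /choice[G GP] := fun l => local_section_uncurry x0 (oU l) (hU l).
have cG l u t : U l u -> {for (u, t), continuous (G l)} by apply: (GP l).1.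
have eG l u (k : 'I_s) : U l u -> G l (u, k%:R / s.-1%:R) = u k by apply: (GP l).2.
have [e e0 eP] := torus_cover_uniform oU cU cG.
have [M M2 Me] : exists2 M, (2 <= M)%N & M%:R^-1 < e.
  exists (Num.bound e^-1).+2 => //.
  have ei : e^-1 < (Num.bound e^-1)%:R by apply: archi_boundP; rewrite invr_ge0 ltW.
  rewrite invf_plt ?posrE ?ltr0n //; apply: lt_le_trans ei _.
  by rewrite ler_nat; lia.
have /choice[cov covP] := anchors_cover.
pose ds := enum free_coords.
(* The path of point [c.2] joins its moving position in configuration [c.1] to a held one in
   configuration [cov c.2]; [W] is its crossing number, computed through time 0. *)
pose W l (c : K) u := path_crossing M (G l) u c.2 (c.1 * M) + path_crossing M (G
  l) u c.2 (cov c.2 * M).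
(* The class of the [l]-th free coordinate is trivialised over [U l] by adding [W]; the default 0 is
   taken off [U l] and for coordinates matched with no set. The correction depends only on the torus
   point, so it is periodic. *)
pose z (c : K) (w : K -> nat) := @winding R M (w c) +
  if insub (index c ds) is Some l then
    if pselect (U l (grid_conf M w)) then W l c (grid_conf M w) else 0
  else 0.
have zq d j w : z d (shift j (4 * M) w) = z d w + (d == j)%:R.
  rewrite /z grid_conf_periodic // addrAC; congr (_ + _); rewrite /shift.
  case: (d == j); last by rewrite mul0n addn0 addr0.
  by rewrite mul1n windingDL // windingL.
have [v vP] := quasi_periodic_cube zq (enum_uniq free_coords).
have [th0 th01 thP] := grid_cube_ball M2 Me v.
have [l lP] := eP th0 th01.
(* There are at most as many sets as free coordinates, so the set containing the cube has a
   coordinate [d] of its own. *)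
have lds : (l < size ds)%N.
  by rewrite -cardE card_free_coords (leq_trans (ltn_ord l)).
have c0 : K by case: (ds) lds => [|c _ _]; [rewrite ltn0|exact: c].
pose d := nth c0 ds l.
have dds : d \in ds by exact: mem_nth.
have [w [w' [vw vw']]] := vP d dds.
have [th wth tau] := thP w vw; have [th' wth' tau'] := thP w' vw'.
have Uw : U l (grid_conf M w) by rewrite tau; have [] := lP th th wth wth.
have Uw' : U l (grid_conf M w') by rewrite tau'; have [] := lP th' th' wth' wth'.
(* Equality here contradicts the choice of the cube at [v]. *)
have -> : z d w = z d w'; last by rewrite eqxx.
have pE u : U l u -> (if pselect (U l u) then W l d u else 0) = W l d u.
  by case: pselect.
rewrite /z index_uniq ?enum_uniq // valK !pE //.
have cl i u u' (t t1 t2 : R) : (u = grid_conf M w \/ u = grid_conf M w') ->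
    (u' = grid_conf M w \/ u' = grid_conf M w') ->
    0 <= t <= 1 -> ball t e t1 -> ball t e t2 ->
    close (coord (G l (u, t1)) i) (coord (G l (u', t2)) i).
  by move=> [->|->] [->|->] t01 b1 b2; rewrite ?tau ?tau';
    [have [_ h] := lP _ _ wth wth|have [_ h] := lP _ _ wth wth'
    |have [_ h] := lP _ _ wth' wth|have [_ h] := lP _ _ wth' wth'];
    exact: (h t t1 t2 t01 b1 b2).
have pc k i := path_crossingD M2 Me s1 k (eG l) Uw Uw' (cl i).
apply/eqP; rewrite -subr_eq0 -[- _]F2_oppr opprK; apply/eqP.
rewrite addrACA (@winding_cube R M M2 (v d)); last 2 first.
- by have := vw d; rewrite finset.in_setT.
- by have := vw' d; rewrite finset.in_setT.
(* The crossings at time 0 occur twice and cancel, the held point contributes nothing, and the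
   crossing of the moving point cancels that of [winding]. *)
rewrite /W addrACA !pc (grid_conf_fixed _ w w' (covP d.2)) crossingpp addr0.
have df : d \in free_coords by rewrite mem_enum in dds.
rewrite !(grid_conf_free M _ df) addrAC F2_addrr add0r.
by rewrite F2_addrr.
Qed.

End LowerBound.

Unset Implicit Arguments.

Theorem corollary5p7 (R : realType) (n s : nat) (a b : circle R)
    (ab : a <> b) (n3 : (3 <= n)%N) (ns : (uphalf n <= s)%N) :
  TC_eq R s (anchored_conf R n [set a; b]) (s * (n - 2))%N.
Proof.
split; last exact: motion_cover_card.
by apply: conf_motion_cover => //; lia.
Qed.
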